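(* Let $a,b>0$. There exist finite constants $C_1,C_2$ depending only on $a$ and $b$ such that (P) $\|f_h'\|_\infty\le C_1\|h'\|_\infty$ for every Lipschitz continuous $h:\mathbb{R}\to\mathbb{R}$, and $\|f_h''\|_\infty\le C_2(\|h'\|_\infty+\|h''\|_\infty)$ for every twice differentiable $h:\mathbb{R}\to\mathbb{R}$ with bounded first and second derivative, where $f_h$ is the solution of the Stein equation for $\nu_{a,b}$ given in the context. For any such constants the following holds. Let $V,V'$ be identically distributed real-valued random variables on a common probability space satisfying $$E[V'-V\mid V]=\lambda(a+b)\Bigl(\frac{a}{a+b}-V\Bigr)+R$$ for some constant $\lambda>0$ and a random variable $R$. Then for each twice differentiable function $h:\mathbb{R}\to\mathbb{R}$ with bounded first and second derivative and with $E[|h(V)|]<\infty$, $$\bigl|E[h(V)]-\nu_{a,b}(h)\bigr|\le C_1\|h'\|_\infty E\Bigl[\Bigl|V(1-V)-\tfrac1{2\lambda}E[(V'-V)^2\mid V]\Bigr|\Bigr]+\frac{C_2(\|h'\|_\infty+\|h''\|_\infty)}{6\lambda}E\bigl[|V'-V|^3\bigr]+\frac{2\|h'\|_\infty}{(a+b)\lambda}E[|R|].$$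
   Context: $\nu_{a,b}$ is the Beta distribution on $[0,1]$ with density $q_{a,b}(x)=\frac{1}{B(a,b)}x^{a-1}(1-x)^{b-1}1_{(0,1)}(x)$, $B(a,b)=\int_0^1x^{a-1}(1-x)^{b-1}dx$; $\nu_{a,b}(h)=\int h\,d\nu_{a,b}$. The Stein equation for $\nu_{a,b}$ is $x(1-x)f'(x)+[-(a+b)x+a]f(x)=\hat h(x)$ with $\hat h:=h-\nu_{a,b}(h)$. The solution $f_h:\mathbb{R}\to\mathbb{R}$ is $f_h(x)=\frac{1}{x(1-x)q_{a,b}(x)}\int_0^x\hat h(t)q_{a,b}(t)\,dt$ for $0<x<1$; $f_h(x)=\frac{1}{|x|^a(1-x)^b}\int_x^0\hat h(t)|t|^{a-1}(1-t)^{b-1}dt$ for $x<0$; $f_h(x)=-\frac{1}{x^a(x-1)^b}\int_1^x\hat h(t)t^{a-1}(t-1)^{b-1}dt$ for $x>1$; $f_h(0)=\hat h(0)/a$, $f_h(1)=-\hat h(1)/b$. $\|\cdot\|_\infty$ is the essential supremum norm on $\mathbb{R}$ (Lebesgue measure); for Lipschitz $h$, $\|h'\|_\infty$ is the minimal Lipschitz constant. The regression identity presupposes that $V'-V$ is integrable; the right-hand side of the bound may be $+\infty$ (in which case nothing is asserted). *)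

(* Defs.v *)
From HB Require Import structures.
From mathcomp Require Import all_boot all_order all_algebra.
From mathcomp Require Import all_classical all_reals all_analysis.
From mathcomp Require Import measurable_realfun.

Set Implicit Arguments.
Unset Strict Implicit.
Unset Printing Implicit Defensive.

Import Order.TTheory GRing.Theory Num.Theory.
Import numFieldNormedType.Exports.

Local Open Scope classical_set_scope.
Local Open Scope ring_scope.

Section beta_law.
Context {R : realType}.
Variables a b : R.

(* The library's beta_fun, beta_pdf and beta_prob only cover natural number
   parameters. Since 0 `^ r = 0 for r != 0 whereas the true integrand may blow
   up at the endpoints, beta_weight is to be read on the open interval. *)
Definition beta_weight (x : R) : R := x `^ (a - 1) * (1 - x) `^ (b - 1).

Definition Beta : R := \int[lebesgue_measure]_(x in `]0, 1[) beta_weight x.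

Definition beta_density (x : R) : R :=
  Beta^-1 * beta_weight x * \1_`]0, 1[ x.

Lemma beta_weight_ge0 x : 0 <= beta_weight x.
Proof. by rewrite mulr_ge0 ?powR_ge0. Qed.

Lemma Beta_ge0 : 0 <= Beta.
Proof. by apply: Rintegral_ge0 => x _; exact: beta_weight_ge0. Qed.

Lemma beta_density_ge0 x : 0 <= beta_density x.
Proof.
by apply: mulr_ge0 => //; apply: mulr_ge0; rewrite ?invr_ge0 ?Beta_ge0 ?beta_weight_ge0.
Qed.

Lemma measurable_beta_weight : measurable_fun setT beta_weight.
Proof.
apply: measurable_funM; first exact: measurable_powR.
apply: (measurableT_comp (measurable_powR (b - 1))).
exact: measurable_funB.
Qed.

Lemma measurable_beta_density : measurable_fun setT beta_density.
Proof.
apply: measurable_funM; last exact: measurable_indic.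
by apply: measurable_funM => //; exact: measurable_beta_weight.
Qed.

Local Open Scope ereal_scope.

Definition beta_law (A : set (measurableTypeR R)) : \bar R :=
  \int[lebesgue_measure]_(x in A) (beta_density x)%:E.

Let beta_law0 : beta_law set0 = 0.
Proof. exact: integral_set0. Qed.

Let beta_law_ge0 A : 0 <= beta_law A.
Proof. by apply: integral_ge0 => x _; rewrite lee_fin beta_density_ge0. Qed.

Let beta_law_sigma_additive : semi_sigma_additive beta_law.
Proof.
move=> /= F mF tF mUF; rewrite /beta_law; apply: cvg_toP.
  apply: ereal_nondecreasing_is_cvgn => m n mn.
  by apply: lee_sum_nneg_natr => // k _ _; exact: beta_law_ge0.
rewrite ge0_integral_bigcup//=.
- by apply/measurable_funTS/measurable_EFinP; exact: measurable_beta_density.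
- by move=> x _; rewrite lee_fin beta_density_ge0.
Qed.

HB.instance Definition _ := isMeasure.Build _ _ _ beta_law
  beta_law0 beta_law_ge0 beta_law_sigma_additive.

End beta_law.

Section stein_solution.
Context {R : realType}.
Variables (a b : R) (h : R -> R).
Local Notation mu := (@lebesgue_measure R).

Definition centered (x : R) : R := h x - \int[beta_law a b]_t h t.

Definition stein_sol (x : R) : R :=
  if x == 0 then centered 0 / a
  else if x == 1 then - centered 1 / b
  else if x < 0 then
    (`|x| `^ a * (1 - x) `^ b)^-1 *
      \int[mu]_(t in `[x, 0]) (centered t * `|t| `^ (a - 1) * (1 - t) `^ (b - 1))
  else if x < 1 then
    (x * (1 - x) * beta_density a b x)^-1 *
      \int[mu]_(t in `[0, x]) (centered t * beta_density a b t)
  else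
    - (x `^ a * (x - 1) `^ b)^-1 *
      \int[mu]_(t in `[1, x]) (centered t * t `^ (a - 1) * (t - 1) `^ (b - 1)).

End stein_solution.

Section norms.
Context {R : realType}.

Definition lip_const (h : R -> R) : R := inf [set k : R | k.-lipschitz h].

(* In the statement ess_norm is only applied to derivatives. derive1 has an
   arbitrary value where a function is not differentiable; for a Stein solution
   of a continuous (resp. differentiable) function this concerns the first
   (resp. second) derivative at 0 and 1 at most, which does not affect an
   essential supremum. *)
Definition ess_norm (f : R -> R) : \bar R :=
  ('N[ @lebesgue_measure R ]_+oo [EFin \o f])%E.

Definition twice_diff_bounded (h : R -> R) : Prop :=
  [/\ forall x, derivable h x 1, forall x, derivable h^`()%classic x 1,
      bounded_fun h^`()%classic & bounded_fun h^`(2)%classic].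

Definition stein_bounds (a b C1 C2 : R) : Prop :=
  (forall h : R -> R, lipschitz h ->
     (ess_norm (stein_sol a b h)^`()%classic <= C1%:E * (lip_const h)%:E)%E) /\
  (forall h : R -> R, twice_diff_bounded h ->
     (ess_norm (stein_sol a b h)^`(2)%classic
        <= C2%:E * ((lip_const h)%:E + ess_norm h^`(2)%classic))%E).

End norms.

Section conditioning.
Context d (T : measurableType d) (R : realType) (P : probability T R).

Definition identically_distributed (X Y : {RV P >-> R}) : Prop :=
  forall A : set R, measurable A -> distribution P X A = distribution P Y A.

(* Z is a version of the conditional expectation E[Y | X]. If Y is integrable
   or nonnegative, these two conditions determine Z almost surely; Z is
   automatically integrable in the former case, and may take the value +oo in
   the latter. *)
Definition is_cond_expectation (X : T -> R) (Y Z : T -> \bar R) : Prop :=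
  measurable_fun [set: g_sigma_algebra_preimageType X] Z /\
  forall A : set T, g_sigma_algebra_preimage X A ->
    (\int[P]_(w in A) Z w = \int[P]_(w in A) Y w)%E.

End conditioning.

(* Main.v *)
Require Import Defs.
From mathcomp Require Import all_boot all_order all_algebra.
From mathcomp Require Import all_classical all_reals all_analysis.
From mathcomp Require Import measurable_realfun ess_sup_inf ring lra.

(** The Stein equation x (1 - x) f' + (a - (a + b) x) f = H is a linear equation of
    first order with integrating factor |x|^a |1 - x|^b. The three integral
    formulas that define the solution are quotients of one primitive of the
    integrand by this factor ([stein_sol_equation]): for a centered right-hand
    side the primitive takes the same value at 0 and at 1, and the quotient is
    the only solution that is not too singular at 0 and at 1.

    The bounds on the solution do not use the integral formulas. Applied to an
    affine function, the Stein operator gives a quadratic polynomial; if the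
    polynomial dominates H between 0 and x, then the affine function dominates
    f at x ([stein_le_affine]). For an L-Lipschitz right-hand side, constants
    give |f| <= L / (a + b) ([stein_sup]) and the limits of f at 0 and 1;
    affine functions give |f x - f 0| = O(|x|), so that in the equation, solved
    for f', the factor x cancels. With the reflection of x into 1 - x and the
    bound on f in the middle of [0, 1] this gives |f'| <= const L
    ([stein_derive_bound]).

    Differentiating the equation shows that f' solves the Stein equation with
    parameters a + 1 and b + 1 and right-hand side H' + (a + b) f
    ([stein_shift]). The same estimate then bounds f'', because this right-hand
    side is Lipschitz; the Lipschitz constant of h' is the essential supremum of
    h'' although h'' need not be continuous ([lipschitz_of_ae_bound]). It also
    follows that f is continuously differentiable on the whole line and that
    f' is Lipschitz. As f' is continuous, and f'' is continuous off 0 and 1,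
    essential suprema bound all their values, whatever the given constants are.

    For the pair (V, V'), let F be an antiderivative of f. From E F(V') = E F(V)
    and a Taylor expansion of F at V to order three, the regression identity and
    the Stein equation give the expectation of h(V) - nu(h) as a sum of three
    terms, each bounded by one of the three terms of the claim
    ([stein_pair_identity], [stein_pair_bound]). Here conditional expectations
    enter through orthogonality to bounded functions of V
    ([bounded_fun_orthogonal]). The moments needed for this computation come from
    the claim itself: if one of its terms is infinite there is nothing to prove,
    and otherwise E |Rem| is finite, so that V is integrable, and the first term
    controls E (V' - V)^2 and E V^2 ([square_integrable_of_cond]). The terms with
    coefficient 0 are excluded from this reasoning and treated apart. *)

Set Implicit Arguments.
Unset Strict Implicit.
Unset Printing Implicit Defensive.

Import Order.TTheory GRing.Theory Num.Theory.
Import numFieldNormedType.Exports.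

Local Open Scope classical_set_scope.
Local Open Scope ring_scope.

(** * Pointwise derivatives *)

Section pointwise_derivatives.
Context {R : realType}.
Implicit Types (f g : R -> R) (x df dg : R).

Lemma is_derive_fun_add f g x df dg :
  is_derive x 1 f df -> is_derive x 1 g dg ->
  is_derive x 1 (fun t => f t + g t) (df + dg).
Proof. by move=> ? ?; exact: is_deriveD. Qed.

Lemma is_derive_fun_opp f x df :
  is_derive x 1 f df -> is_derive x 1 (fun t => - f t) (- df).
Proof. by move=> ?; exact: is_deriveN. Qed.

Lemma is_derive_fun_mul f g x df dg :
  is_derive x 1 f df -> is_derive x 1 g dg ->
  is_derive x 1 (fun t => f t * g t) (df * g x + f x * dg).
Proof.
move=> hf hg; apply: (is_derive_eq (is_deriveM hf hg)).
by rewrite /GRing.scale/=; ring.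
Qed.

Lemma is_derive_fun_inv f x df : f x != 0 ->
  is_derive x 1 f df -> is_derive x 1 (fun t => (f t)^-1) (- df / f x ^+ 2).
Proof.
move=> fx0 hf; split.
  by apply: derivableV => //; exact: ex_derive.
rewrite deriveV// derive_val /GRing.scale/= !mulNr; congr (- _).
by rewrite mulrC.
Qed.

Lemma is_derive_fun_comp f g x df dg :
  is_derive (g x) 1 f df -> is_derive x 1 g dg ->
  is_derive x 1 (fun t => f (g t)) (dg * df).
Proof.
by move=> hf hg; rewrite mulrC; exact: (@is_derive1_comp _ f g x df dg hf hg).
Qed.

Lemma is_derive_affine (c k x : R) : is_derive x 1 (fun t => c + k * t) k.
Proof.
apply: (@is_derive_eq _ _ _ _ _ _ _ (0 + (0 * x + k * 1))); last ring.
by apply: is_derive_fun_add; apply: is_derive_fun_mul.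
Qed.

Lemma is_derive_onem (x : R) : is_derive x 1 (fun t => 1 - t) (- 1).
Proof.
have := is_derive_affine 1 (- 1) x.
by rewrite (_ : (fun _ => _) = fun s => 1 - s)//; apply/funext => s; rewrite mulN1r.
Qed.

Lemma is_derive_near f g x df :
  (\forall y \near x, f y = g y) -> is_derive x 1 f df -> is_derive x 1 g df.
Proof. by move=> fg; apply: near_eq_is_derive. Qed.

Lemma is_derive_powR (e x : R) : 0 < x ->
  is_derive x 1 (fun t => t `^ e) (e * x `^ e / x).
Proof.
move=> x0; apply: (is_derive_eq (is_derive1_powR e x0)).
have xn : x != 0 by rewrite gt_eqF.
by rewrite -mulrA; congr (_ * _); rewrite powRB ?xn ?implybT// powRr1// ltW.
Qed.

Lemma is_derive_continuous f x df : is_derive x 1 f df -> {for x, continuous f}.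
Proof.
move=> h; apply: differentiable_continuous; apply/derivable1_diffP.
exact: ex_derive.
Qed.

Lemma is_derive_derive1 f x df : is_derive x 1 f df -> f^`()%classic x = df.
Proof. by move=> h; rewrite derive1E derive_val. Qed.

Lemma cvg_eq_lim (T : Type) (F : set_system T) (f : T -> R) (l l' : R) :
  f x @[x --> F] --> l -> l = l' -> f x @[x --> F] --> l'.
Proof. by move=> h <-. Qed.

Lemma near_neq (x c : R) : x != c -> \forall y \near x, y != c.
Proof. by move=> xc; apply: open_nbhs_nbhs; split; [exact: open_neq|]. Qed.

End pointwise_derivatives.

(** * The Stein equation and its comparison principle *)

Section stein_equation.
Context {R : realType}.

(** The coefficient x (1 - x) vanishes at 0 and 1, so the equation is imposed off
    these points only. On each of the three remaining intervals the homogeneous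
    equation is solved by the multiples of |x|^-a |1 - x|^-b; the two boundary
    conditions exclude all of them but 0, so that a solution is determined by the
    right-hand side. *)
Record stein_equation (a b : R) (f df H : R -> R) : Prop := SteinEquation {
  stein_derive : forall x : R, x != 0 -> x != 1 -> is_derive x 1 f (df x) ;
  stein_ode : forall x : R, x != 0 -> x != 1 ->
    x * (1 - x) * df x + (a - (a + b) * x) * f x = H x ;
  stein_boundary0 : `|t| `^ a * f t @[t --> (0 : R)^'] --> (0 : R) ;
  stein_boundary1 : `|1 - t| `^ b * f t @[t --> (1 : R)^'] --> (0 : R) }.

Lemma cvg_dnbhs_onem (c : R) : 1 - t @[t --> (c : R)^'] --> (1 - c)^'.
Proof.
move=> A /= [e e0 hA]; exists e => // t /= te tc; apply: hA => /=.
  by rewrite (_ : _ - _ = t - c) 1?distrC//; ring.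
by apply: contra_neq tc => /addrI/oppr_inj.
Qed.

(** The substitution of 1 - x for x exchanges a and b: what is proved at 0 and on
    the negative half-line transfers to 1 and to the half-line beyond 1. *)
Lemma stein_reflect (a b : R) (f df H : R -> R) : stein_equation a b f df H ->
  stein_equation b a (fun x => - f (1 - x)) (fun x => df (1 - x))
    (fun x => H (1 - x)).
Proof.
have ne0 (x : R) : x != 1 -> 1 - x != 0 by rewrite subr_eq0 eq_sym.
have ne1 (x : R) : x != 0 -> 1 - x != 1.
  by apply: contra_neq => h; lra.
move=> [hd ho h0 h1]; split.
- move=> x x0 x1.
  have h : is_derive x 1 (fun t => f (1 - t)) (- 1 * df (1 - x)).
    by apply: is_derive_fun_comp; [exact: hd (ne0 _ x1) (ne1 _ x0)|exact: is_derive_onem].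
  by apply: (is_derive_eq (is_derive_fun_opp h)); rewrite mulN1r opprK.
- move=> x x0 x1; rewrite -(ho _ (ne0 _ x1) (ne1 _ x0)); ring.
- have := @cvg_dnbhs_onem 0; rewrite subr0 => /cvg_comp /(_ h1) /cvgN.
  rewrite oppr0; apply: cvg_trans; apply: near_eq_cvg; apply: nearW => t.
  by rewrite fctE /= ?fctE subKr mulrN.
- have := @cvg_dnbhs_onem 1; rewrite subrr => /cvg_comp /(_ h0) /cvgN.
  rewrite oppr0; apply: cvg_trans; apply: near_eq_cvg; apply: nearW => t.
  by rewrite fctE /= ?fctE mulrN.
Qed.

Lemma stein_opp (a b : R) (f df H : R -> R) : stein_equation a b f df H ->
  stein_equation a b (fun x => - f x) (fun x => - df x) (fun x => - H x).
Proof.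
move=> [hd ho h0 h1]; split.
- by move=> x x0 x1; apply: is_derive_fun_opp; exact: hd.
- by move=> x x0 x1; rewrite -(ho _ x0 x1); ring.
- move/cvgN : h0; rewrite oppr0; apply: cvg_trans; apply: near_eq_cvg.
  by apply: nearW => t; rewrite fctE /= ?fctE mulrN.
- move/cvgN : h1; rewrite oppr0; apply: cvg_trans; apply: near_eq_cvg.
  by apply: nearW => t; rewrite fctE /= ?fctE mulrN.
Qed.

Lemma decreasing_from_limit0 (phi dphi : R -> R) :
  (forall s : R, 0 < s <= 1 -> is_derive s 1 phi (dphi s)) ->
  (forall s : R, 0 < s <= 1 -> dphi s <= 0) ->
  phi s @[s --> 0^'+] --> 0 -> phi 1 <= 0.
Proof.
move=> hd hle hcvg.
have h s : 0 < s < 1 -> phi 1 <= phi s.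
  move=> /andP[s0 s1]; rewrite -subr_ge0.
  have hin x : x \in `[s, 1] -> 0 < x <= 1.
    by rewrite in_itv/= => /andP[sx ->]; rewrite (lt_le_trans s0).
  have [||c cs E] := @MVT _ phi dphi _ _ s1.
  - by move=> x /subset_itv_oo_cc /hin /hd.
  - apply: continuous_in_subspaceT => x; rewrite inE/= => /hin /hd.
    exact: is_derive_continuous.
  - rewrite -oppr_le0 opprB E mulr_le0_ge0//; last by rewrite subr_ge0 ltW.
    by apply/hle/hin/subset_itv_oo_cc.
apply: (ler_cvg_to (cvg_cst (phi 1)) hcvg); near=> s; apply: h; apply/andP; split; near: s.
  exact: nbhs_right_gt.
exact: nbhs_right_lt.
Unshelve. all: by end_near. Qed.

Lemma cvg_mulr_dnbhs0 (x : R) : x != 0 ->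
  s * x @[s --> (0 : R)^'+] --> (0 : R)^'.
Proof.
move=> x0 A /= [e e0 hA]; suff : \forall s \near (0 : R)^'+, A (s * x) by [].
near=> s; apply: hA => /=.
  rewrite sub0r normrN normrM -ltr_pdivlMr ?normr_gt0//; near: s.
  exists (e / `|x|); first by rewrite /= divr_gt0 ?normr_gt0.
  by move=> s /=; rewrite sub0r normrN.
by rewrite mulf_neq0// gt_eqF//; near: s; exact: nbhs_right_gt.
Unshelve. all: by end_near. Qed.

(** A comparison principle with affine functions. The expression bounding H is
    the Stein operator applied to al + be y at y = s x. The integrating factor
    therefore makes |y|^a |1 - y|^b (f y - al - be y) nonincreasing when y runs
    from 0 to x, and the boundary condition makes it start from the value 0. *)
Lemma stein_le_affine (a b : R) (f df H : R -> R) (al be x : R) : 0 < a ->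
  stein_equation a b f df H -> x != 0 -> x < 1 ->
  (forall s : R, 0 < s <= 1 -> H (s * x) <=
    al * (a - (a + b) * (s * x)) +
    be * (s * x) * (a + 1 - (a + b + 1) * (s * x))) ->
  f x <= al + be * x.
Proof.
move=> a0 [hd ho h0 _] x0 x1 hH.
pose Q (t : R) := al * (a - (a + b) * t) + be * t * (a + 1 - (a + b + 1) * t).
pose phi (s : R) := s `^ a * (1 - s * x) `^ b * (f (s * x) - (al + be * (s * x))).
pose dphi (s : R) := s `^ a * (1 - s * x) `^ b / (s * (1 - s * x)) *
  (H (s * x) - Q (s * x)).
have sx1 (s : R) : 0 < s <= 1 -> 0 < 1 - s * x by nra.
suff : phi 1 <= 0.
  rewrite /phi powR1 !mul1r pmulr_rle0; last by rewrite powR_gt0// subr_gt0.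
  by rewrite subr_le0.
apply: (@decreasing_from_limit0 phi dphi).
- move=> s s01; have sx := sx1 _ s01; have s0 : 0 < s by case/andP: s01.
  have sxn0 : s * x != 0 by rewrite mulf_neq0// gt_eqF.
  have sxn1 : s * x != 1 by rewrite lt_eqF// -subr_gt0.
  have hlin (c k : R) : is_derive s 1 (fun t => c + k * (t * x)) (k * x).
    rewrite (_ : (fun t => _) = fun t => c + (k * x) * t).
      exact: is_derive_affine.
    by apply/funext => t; ring.
  have hx : is_derive s 1 (fun t => t * x) x.
    have := hlin 0 1; rewrite mul1r (_ : (fun t => _) = fun t => t * x)//.
    by apply/funext => t; ring.
  have h1x : is_derive s 1 (fun t => 1 - t * x) (- x).
    have := hlin 1 (- 1); rewrite mulN1r (_ : (fun t => _) = fun t => 1 - t * x)//.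
    by apply/funext => t; ring.
  have hpow := is_derive_fun_mul (is_derive_powR a s0)
     (@is_derive_fun_comp _ (fun t => t `^ b) (fun t => 1 - t * x) _ _ _
       (is_derive_powR b sx) h1x).
  have hf := @is_derive_fun_comp _ f (fun t => t * x) _ _ _ (hd _ sxn0 sxn1) hx.
  have hm := is_derive_fun_add hf (is_derive_fun_opp (hlin al be)).
  apply: (is_derive_eq (is_derive_fun_mul hpow hm)).
  rewrite /dphi /Q -(ho _ sxn0 sxn1); field.
  by rewrite !gt_eqF.
- move=> s s01; have sx := sx1 _ s01; have s0 : 0 < s by case/andP: s01.
  rewrite /dphi mulr_ge0_le0 ?subr_le0 ?hH//.
  by rewrite divr_ge0 ?mulr_ge0 ?powR_ge0 ?(ltW sx) ?(ltW s0).
- have hsx : s * x @[s --> 0^'+] --> 0^'.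
    exact: cvg_mulr_dnbhs0.
  have hs0 : s * x @[s --> (0 : R)^'+] --> (0 : R).
    by apply: cvg_trans hsx _; exact: nbhs_dnbhs.
  have hA : s `^ a * f (s * x) @[s --> (0 : R)^'+] --> (0 : R).
    have /(cvgM (cvg_cst (`|x| `^ a)^-1)) := cvg_comp _ _ hsx h0; rewrite mulr0.
    apply: cvg_trans; apply: near_eq_cvg; near=> s => /=.
    have s0 : 0 < s by near: s; exact: nbhs_right_gt.
    rewrite normrM gtr0_norm// powRM// ?ltW// mulrA; congr (_ * _).
    by rewrite mulrC mulrK// unitfE gt_eqF// powR_gt0// normr_gt0.
  have hB : (1 - s * x) `^ b @[s --> (0 : R)^'+] --> (1 : R).
    have h1 : 1 - s * x @[s --> (0 : R)^'+] --> (1 : R).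
      by rewrite -[X in _ --> X]subr0; apply: cvgB => //; exact: cvg_cst.
    have := is_derive_continuous (is_derive_powR b (@ltr01 R)).
    by move=> /(cvg_comp _ _ h1); rewrite powR1.
  have hC : s `^ a * (al + be * (s * x)) @[s --> (0 : R)^'+] --> (0 : R).
    rewrite -[X in _ --> X](mul0r (al + be * 0)); apply: cvgM.
      exact: powR_cvg0.
    by apply: cvgD; [exact: cvg_cst|apply: cvgM => //; exact: cvg_cst].
  have -> : phi = fun s => (1 - s * x) `^ b * (s `^ a * f (s * x) -
      s `^ a * (al + be * (s * x))).
    by apply/funext => s; rewrite /phi; ring.
  rewrite -[X in _ --> X](mul1r 0) -[X in 1 * X](subr0 0).
  by apply: cvgM => //; apply: cvgB.
Unshelve. all: by end_near. Qed.

End stein_equation.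

(** * Bounds on a solution and on its derivative *)

Section stein_bounds.
Context {R : realType}.
Implicit Types (a b : R) (f df H : R -> R).

Lemma stein_ge_affine a b f df H (al be x : R) : 0 < a ->
  stein_equation a b f df H -> x != 0 -> x < 1 ->
  (forall s : R, 0 < s <= 1 ->
    al * (a - (a + b) * (s * x)) +
    be * (s * x) * (a + 1 - (a + b + 1) * (s * x)) <= H (s * x)) ->
  al + be * x <= f x.
Proof.
move=> a0 hf x0 x1 hH; rewrite -lerN2 opprD -mulNr.
apply: (stein_le_affine a0 (stein_opp hf) x0 x1) => s s01.
by have := hH _ s01; lra.
Qed.

(** Close to 0 the Stein operator maps a constant c to about a c, so that the
    constants H0 / a - e and H0 / a + e enclose the solution. *)
Lemma stein_cvg0 a b f df H (H0 : R) : 0 < a -> 0 < b ->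
  stein_equation a b f df H -> H t @[t --> (0 : R)^'] --> H0 ->
  f t @[t --> (0 : R)^'] --> H0 / a.
Proof.
move=> a0 b0 hf hH; apply/cvgrPdist_le => /= e e0.
have [ea0 ea2] : 0 < e * a / 2 /\ 0 < e * a by split; nra.
have [d /= d0 hd] := (cvgrPdist_le _ _).1 hH _ ea0.
pose k := (a + b) * (`|H0| / a + e).
have k0 : 0 < k by apply: mulr_gt0; [exact: addr_gt0|rewrite ltr_wpDl// divr_ge0// ltW].
pose r := Num.min (Num.min d 1) (e * a / (2 * k)).
have r0 : 0 < r by rewrite /r !lt_min d0 ltr01/= divr_gt0// mulr_gt0.
exists r => // x /=; rewrite sub0r normrN => xr x0.
have [xd x1 xk] : [/\ `|x| < d, `|x| < 1 & `|x| < e * a / (2 * k)].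
  by move: xr; rewrite /r !lt_min => /andP[/andP[]].
have x1' : x < 1 by rewrite (le_lt_trans (ler_norm _)).
have key (s : R) : 0 < s <= 1 ->
    `|H0 - H (s * x)| <= e * a / 2 /\ (a + b) * `|s * x| * (`|H0| / a + e) <= e * a / 2.
  move=> /andP[s0 s1].
  have sx : `|s * x| <= `|x| by rewrite normrM gtr0_norm// ler_piMl.
  split.
    apply: hd; first by rewrite /= sub0r normrN (le_lt_trans sx).
    by rewrite mulf_neq0// gt_eqF.
  rewrite mulrAC -/k; apply: (@le_trans _ _ (k * (e * a / (2 * k)))).
    by rewrite ler_pM2l// (le_trans sx)// ltW.
  by rewrite le_eqVlt; apply/orP; left; apply/eqP; field; rewrite gt_eqF.
have bnd (c y : R) : `|c| <= `|H0| / a + e ->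
    (a + b) * `|y| * (`|H0| / a + e) <= e * a / 2 -> `|(a + b) * y * c| <= e * a / 2.
  move=> hc; apply: le_trans; rewrite !normrM (gtr0_norm (addr_gt0 a0 b0)).
  by rewrite ler_wpM2l// mulr_ge0// ltW// addr_gt0.
have H0a : `|H0 / a| = `|H0| / a by rewrite normrM (gtr0_norm (_ : 0 < a^-1)) ?invr_gt0.
have aK : H0 / a * a = H0 by rewrite divfK ?gt_eqF.
rewrite ler_distlC; apply/andP; split.
- rewrite -[leLHS]addr0 -(mul0r x); apply: (stein_ge_affine a0 hf x0 x1').
  move=> s /key[h1 h2]; rewrite mul0r mul0r addr0.
  have := bnd (H0 / a - e) (s * x); rewrite h2 => /(_ _ isT).
  move/(_ (le_trans (ler_normB _ _) _)); rewrite H0a (gtr0_norm e0) => /(_ (lexx _)).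
  move: h1; rewrite !ler_norml => /andP[_ h1] /andP[h3 h4].
  have -> : (H0 / a - e) * (a - (a + b) * (s * x)) = H0 - e * a - (a + b) * (s * x) * (H0 / a - e).
    rewrite [LHS](_ : _ = H0 / a * a - e * a - (a + b) * (s * x) * (H0 / a - e)).
      by rewrite aK.
    by ring.
  lra.
- rewrite -[leRHS]addr0 -(mul0r x); apply: (stein_le_affine a0 hf x0 x1').
  move=> s /key[h1 h2]; rewrite mul0r mul0r addr0.
  have := bnd (H0 / a + e) (s * x); rewrite h2 => /(_ _ isT).
  move/(_ (le_trans (ler_normD _ _) _)); rewrite H0a (gtr0_norm e0) => /(_ (lexx _)).
  move: h1; rewrite !ler_norml => /andP[h1 _] /andP[h3 h4].
  have -> : (H0 / a + e) * (a - (a + b) * (s * x)) = H0 + e * a - (a + b) * (s * x) * (H0 / a + e).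
    rewrite [LHS](_ : _ = H0 / a * a + e * a - (a + b) * (s * x) * (H0 / a + e)).
      by rewrite aK.
    by ring.
  lra.
Qed.

Lemma stein_cvg1 a b f df H (H1 : R) : 0 < a -> 0 < b ->
  stein_equation a b f df H -> H t @[t --> (1 : R)^'] --> H1 ->
  f t @[t --> (1 : R)^'] --> - (H1 / b).
Proof.
move=> a0 b0 hf hH.
have hH' : H (1 - t) @[t --> (0 : R)^'] --> H1.
  by have := @cvg_dnbhs_onem R 0; rewrite subr0 => /cvg_comp; apply.
have hl := stein_cvg0 b0 a0 (stein_reflect hf) hH'.
have := @cvg_dnbhs_onem R 1; rewrite subrr => /cvg_comp /(_ hl) /cvgN.
apply: cvg_trans; apply: near_eq_cvg; apply: nearW => t.
by rewrite fctE /= opprK subKr.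
Qed.

(** Put m = H0 / a. Subtracting its value at 0 from the equation gives
      x (1 - x) f' x = (H x - H0 + (a + b) x m) - (a - (a + b) x) (f x - m),
    where the first bracket is O(x). Comparison with the affine functions through
    m at 0 shows that f x - m is O(x) too, and the factor x cancels. The range of
    x is the one where a + 1 - (a + b + 1) x is bounded away from 0, which makes
    a linear function with large slope a barrier. *)
Lemma stein_derive_bound0 a b f df H (H0 L M x : R) : 0 < a -> 0 < b ->
  stein_equation a b f df H ->
  0 <= L -> 0 <= M -> (forall t, `|H t - H0| <= L * `|t|) -> `|H0| <= a * M ->
  x != 0 -> x <= (a + 1) / (2 * (a + b + 1)) ->
  `|df x| <= (2 + 2 * (a + b)) * (L + (a + b) * M).
Proof.
move=> a0 b0 hf L0 M0 hH hH0 x0 xle.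
have xle' : 2 * (a + b + 1) * x <= a + 1.
  by move: xle; rewrite ler_pdivlMr ?mulr_gt0 ?addr_gt0// mulrC.
have x2 : x <= 2^-1 by nra.
have x1 : x < 1 by lra.
have [m aK] : exists m, H0 = a * m by exists (H0 / a); rewrite mulrC divfK ?gt_eqF.
have mM : `|m| <= M by move: hH0; rewrite aK normrM gtr0_norm// ler_pM2l.
pose L' := L + (a + b) * M.
have L'0 : 0 <= L' by rewrite addr_ge0// mulr_ge0// addr_ge0// ltW.
have hHb (t : R) : `|H t - H0 + (a + b) * t * m| <= L' * `|t|.
  rewrite (le_trans (ler_normD _ _))// /L' [leRHS]mulrDl lerD//.
  rewrite !normrM (gtr0_norm (addr_gt0 a0 b0)) mulrAC ler_wpM2r//.
  by rewrite ler_wpM2l// ltW// addr_gt0.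
have hQ (s : R) : 0 < s <= 1 -> 2^-1 <= a + 1 - (a + b + 1) * (s * x) by nra.
have sgx (s : R) : 0 < s <= 1 -> Num.sg x * (s * x) = `|s * x|.
  by move=> /andP[s0 _]; rewrite normrM gtr0_norm// mulrCA -normrEsg.
have hfm : `|f x - m| <= 2 * L' * `|x|.
  rewrite ler_distl !(normrEsg x) !mulrA; apply/andP; split.
    rewrite -mulNr; apply: (stein_ge_affine a0 hf x0 x1) => s s01.
    have -> : - (2 * L' * Num.sg x) * (s * x) = - (2 * L' * `|s * x|).
      by rewrite -sgx//; ring.
    have := hHb (s * x); rewrite ler_norml => /andP[h _].
    have := hQ _ s01; have := mulr_ge0 L'0 (normr_ge0 (s * x)).
    move: h; rewrite aK; nra.
  apply: (stein_le_affine a0 hf x0 x1) => s s01.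
  have -> : 2 * L' * Num.sg x * (s * x) = 2 * L' * `|s * x|.
    by rewrite -sgx//; ring.
  have := hHb (s * x); rewrite ler_norml => /andP[_ h].
  have := hQ _ s01; have := mulr_ge0 L'0 (normr_ge0 (s * x)).
  move: h; rewrite aK; nra.
have x1n : x != 1 by rewrite lt_eqF.
have E : x * (1 - x) * df x =
    (H x - H0 + (a + b) * x * m) - (a - (a + b) * x) * (f x - m).
  by rewrite -(stein_ode hf x0 x1n) aK; ring.
have h1 : `|a - (a + b) * x| <= (a + b) * (1 - x).
  by rewrite ler_norml; apply/andP; split; nra.
have h2 : `|x| * ((1 - x) * `|df x|) <= `|x| * (L' * (1 + 2 * (a + b) * (1 - x))).
  rewrite -{1}(gtr0_norm (_ : 0 < 1 - x)) ?subr_gt0// mulrA -!normrM E.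
  rewrite (le_trans (ler_normB _ _))//.
  rewrite [leRHS](_ : _ = L' * `|x| + (a + b) * (1 - x) * (2 * L' * `|x|)); last ring.
  by rewrite lerD// normrM ler_pM.
move: h2; rewrite ler_pM2l ?normr_gt0// => h2.
have ab0 := addr_gt0 a0 b0.
have h3 : (1 - x) * `|df x| <= (1 - x) * ((2 + 2 * (a + b)) * L').
  apply: (le_trans h2).
  rewrite [leRHS](_ : _ = L' * (2 * (1 - x) + 2 * (a + b) * (1 - x))); last ring.
  by rewrite ler_wpM2l// lerD2r; lra.
by move: h3; rewrite ler_pM2l// subr_gt0.
Qed.

Lemma at_right_dnbhs (c : R) : c^'+ `=>` c^'.
Proof.
by move=> A [e e0 h]; exists e => // y ye y0; apply: h => //; rewrite gt_eqF.
Qed.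

Lemma lipschitz_cvg_dnbhs H (L c : R) :
  (forall s t, `|H s - H t| <= L * `|s - t|) -> H t @[t --> c^'] --> H c.
Proof.
move=> hH; apply/cvgrPdist_le => e e0.
have L1 : 0 < `|L| + 1 by rewrite ltr_wpDl.
exists (e / (`|L| + 1)) => /=; first by rewrite divr_gt0.
move=> t /= /ltW; rewrite ler_pdivlMr// => tc _; rewrite (le_trans (hH _ _))//.
rewrite (le_trans _ tc)// mulrC ler_wpM2l// (le_trans (ler_norm _))// lerDl.
by rewrite ler01.
Qed.

(** With al = L / (a + b), the function al (a - (a + b) s) has slope - L. If it is
    above H at x, it stays above H on [0, x] because H is L-Lipschitz, and the
    constant al is a barrier for the comparison that starts at 0. Otherwise it
    is below H on [x, 1], and the comparison that starts at 1 applies. *)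
Lemma stein_le_in a b f df H (L x : R) : 0 < a -> 0 < b ->
  stein_equation a b f df H ->
  (forall s t, `|H s - H t| <= L * `|s - t|) -> 0 < x < 1 ->
  f x <= L / (a + b).
Proof.
move=> a0 b0 hf hH /andP[x0 x1].
have ab0 : 0 < a + b by rewrite addr_gt0.
have [al al_ab ->] : exists2 al, al * (a + b) = L & L / (a + b) = al.
  by exists (L / (a + b)) => //; rewrite divfK// gt_eqF.
have mono (s t : R) : s <= t -> H s - H t <= L * (t - s).
  move=> st; rewrite (le_trans (ler_norm _))// (le_trans (hH _ _))//.
  by rewrite distrC ger0_norm ?subr_ge0.
have [hx|hx] := leP (H x) (al * (a - (a + b) * x)).
  rewrite -[leRHS]addr0 -(mul0r x).
  apply: (stein_le_affine a0 hf) => //; first by rewrite gt_eqF.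
  move=> s /andP[s0 s1]; have sx : s * x <= x by nra.
  have := mono _ _ sx; rewrite -al_ab; nra.
have y0 : 1 - x != 0 by rewrite gt_eqF// subr_gt0.
have y1 : 1 - x < 1 by lra.
have := @stein_ge_affine b a _ _ _ (- al) 0 (1 - x) b0 (stein_reflect hf) y0 y1.
rewrite mul0r addr0 subKr lerN2; apply=> s /andP[s0 s1].
have sx : x <= 1 - s * (1 - x) by nra.
have := mono _ _ sx; rewrite -al_ab; nra.
Qed.

Lemma stein_sup_in a b f df H (L x : R) : 0 < a -> 0 < b ->
  stein_equation a b f df H ->
  (forall s t, `|H s - H t| <= L * `|s - t|) -> 0 < x < 1 ->
  `|f x| <= L / (a + b).
Proof.
move=> a0 b0 hf hH x01; rewrite ler_norml lerNl.
rewrite (stein_le_in a0 b0 hf)// andbT.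
apply: (stein_le_in a0 b0 (stein_opp hf)) => // s t.
by rewrite -opprD normrN.
Qed.

(** The value of H at 0 is a times the limit of the solution, which inherits the
    bound that holds inside the interval. No mean value of H occurs: that H is
    centered is implicit in the existence of a solution with both boundary
    conditions. *)
Lemma stein_rhs0 a b f df H (L : R) : 0 < a -> 0 < b ->
  stein_equation a b f df H ->
  (forall s t, `|H s - H t| <= L * `|s - t|) -> `|H 0| <= a * (L / (a + b)).
Proof.
move=> a0 b0 hf hH; rewrite mulrC -ler_pdivrMr//.
have <- : `|H 0 / a| = `|H 0| / a by rewrite normrM normfV (gtr0_norm a0).
have hc := stein_cvg0 a0 b0 hf (@lipschitz_cvg_dnbhs H L 0 hH).
have hc' : `|f t| @[t --> (0 : R)^'+] --> `|H 0 / a|.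
  by apply: cvg_norm; apply: cvg_trans hc; apply: cvg_app; exact: at_right_dnbhs.
apply: (ler_cvg_to hc' (cvg_cst _)).
near=> t; apply: (stein_sup_in a0 b0 hf) => //; apply/andP; split.
  by near: t; exact: nbhs_right_gt.
by near: t; exact: nbhs_right_lt.
Unshelve. all: by end_near. Qed.

Lemma stein_rhs1 a b f df H (L : R) : 0 < a -> 0 < b ->
  stein_equation a b f df H ->
  (forall s t, `|H s - H t| <= L * `|s - t|) -> `|H 1| <= b * (L / (a + b)).
Proof.
move=> a0 b0 hf hH; have := @stein_rhs0 b a _ _ _ L b0 a0 (stein_reflect hf).
rewrite subr0 addrC; apply=> s t; rewrite (le_trans (hH _ _))//.
by rewrite (_ : 1 - s - (1 - t) = t - s) 1?distrC//; ring.
Qed.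

(** With al = L / (a + b) and |H 0| <= a al, the Lipschitz bound on the negative
    half-line reads H y <= al (a - (a + b) y), so the constant al is a barrier. *)
Lemma stein_le_left a b f df H (L x : R) : 0 < a -> 0 < b ->
  stein_equation a b f df H ->
  (forall s t, `|H s - H t| <= L * `|s - t|) -> x < 0 ->
  f x <= L / (a + b).
Proof.
move=> a0 b0 hf hH x0.
have := stein_rhs0 a0 b0 hf hH.
have [al al_ab ->] : exists2 al, al * (a + b) = L & L / (a + b) = al.
  by exists (L / (a + b)) => //; rewrite divfK// gt_eqF// addr_gt0.
move=> h0; rewrite -[leRHS]addr0 -(mul0r x).
apply: (stein_le_affine a0 hf); [by rewrite lt_eqF|exact: lt_trans ltr01|].
move=> s /andP[s0 s1]; have := le_trans (ler_norm _) (hH (s * x) 0).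
have := le_trans (ler_norm _) h0.
have sx : s * x < 0 by nra.
rewrite subr0 ltr0_norm// -al_ab; nra.
Qed.

Lemma stein_sup a b f df H (L x : R) : 0 < a -> 0 < b ->
  stein_equation a b f df H ->
  (forall s t, `|H s - H t| <= L * `|s - t|) -> x != 0 -> x != 1 ->
  `|f x| <= L / (a + b).
Proof.
have left a' b' f' df' H' x' : 0 < a' -> 0 < b' -> stein_equation a' b' f' df' H' ->
    (forall s t, `|H' s - H' t| <= L * `|s - t|) -> x' < 0 ->
    `|f' x'| <= L / (a' + b').
  move=> a0 b0 hf hH x0; rewrite ler_norml lerNl (stein_le_left a0 b0 hf)// andbT.
  apply: (stein_le_left a0 b0 (stein_opp hf)) => // s t.
  by rewrite -opprD normrN.
move=> a0 b0 hf hH x0 x1; have [xlt0|xge0] := ltP x 0; first exact: left hf _ _.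
have [xlt1|xge1] := ltP x 1.
  by apply: (stein_sup_in a0 b0 hf) => //; rewrite lt_def x0 xge0 xlt1.
have xgt1 : 1 - x < 0 by rewrite subr_lt0 lt_def x1 xge1.
have := left _ _ _ _ _ _ b0 a0 (stein_reflect hf) _ xgt1.
rewrite subKr normrN addrC; apply=> s t; rewrite (le_trans (hH _ _))//.
by rewrite (_ : 1 - s - (1 - t) = t - s) 1?distrC//; ring.
Qed.

(** The first two terms come from [stein_derive_bound0] and its reflection. The
    last one comes from the rest of [0, 1], where
    x (1 - x) >= (a + 1) (b + 1) / (2 (a + b + 1))^2. *)
Definition stein_factor a b : R :=
  2 + 2 * (a + b) + 8 * (a + b + 1) ^+ 2 / ((a + 1) * (b + 1)).

(** [stein_derive_bound0] covers all x up to a point of (0, 1), and after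
    reflection all x from another such point on. In between, the equation can
    be divided by x (1 - x). *)
Lemma stein_derive_bound a b f df H (L M x : R) : 0 < a -> 0 < b ->
  stein_equation a b f df H -> 0 <= L ->
  (forall s t, `|H s - H t| <= L * `|s - t|) ->
  `|H 0| <= a * M -> `|H 1| <= b * M ->
  (forall t, t != 0 -> t != 1 -> `|f t| <= M) -> x != 0 -> x != 1 ->
  `|df x| <= stein_factor a b * (L + (a + b) * M).
Proof.
move=> a0 b0 hf L0 hH H0 H1 hM x0 x1.
have M0 : 0 <= M by rewrite (le_trans (normr_ge0 _) (hM _ x0 x1)).
have ab0 : 0 < a + b by rewrite addr_gt0.
have ab1 : 0 < (a + 1) * (b + 1) by rewrite mulr_gt0// addr_gt0.
have LM0 : 0 <= L + (a + b) * M by rewrite addr_ge0// mulr_ge0// ltW.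
have F0 : 0 <= 8 * (a + b + 1) ^+ 2 / ((a + 1) * (b + 1)).
  by apply: divr_ge0; [rewrite mulr_ge0// sqr_ge0|exact: ltW].
have near0 : (2 + 2 * (a + b)) * (L + (a + b) * M) <=
    stein_factor a b * (L + (a + b) * M).
  by rewrite ler_wpM2r// lerDl.
have D0 : 0 < 2 * (a + b + 1) by rewrite mulr_gt0// addr_gt0.
have [xl|xr] := leP x ((a + 1) / (2 * (a + b + 1))).
  apply: le_trans near0; apply: (stein_derive_bound0 a0 b0 hf L0 M0 _ H0) => // t.
  by have := hH t 0; rewrite subr0.
have [xl'|xr'] := leP (1 - x) ((b + 1) / (2 * (b + a + 1))).
  apply: le_trans near0.
  have -> : df x = df (1 - (1 - x)) by rewrite subKr.
  rewrite (addrC a b); apply: (stein_derive_bound0 b0 a0 (stein_reflect hf) L0 M0 _ H1) => //.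
  - move=> t /=; have := hH (1 - t) 1.
    by rewrite (_ : 1 - t - 1 = - t) ?normrN//; ring.
  - by rewrite subr_eq0 eq_sym.
move: xr xr'; rewrite (addrC b a) !ltr_pdivrMr// => xr xr'.
have xx : (a + 1) * (b + 1) <= x * (1 - x) * (2 * (a + b + 1)) ^+ 2.
  rewrite [leRHS](_ : _ = (x * (2 * (a + b + 1))) * ((1 - x) * (2 * (a + b + 1)))); last ring.
  by rewrite ler_pM ?addr_ge0// ltW.
have x01 : 0 < x * (1 - x).
  have : 0 < x * (1 - x) * (2 * (a + b + 1)) ^+ 2 by exact: lt_le_trans xx.
  by rewrite pmulr_lgt0// exprn_gt0.
have xlt : 0 < x < 1 by apply/andP; split; nra.
have hb : `|x * (1 - x) * df x| <= 2 * (L + (a + b) * M).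
  have -> : x * (1 - x) * df x = (H x - H 0) + H 0 - (a - (a + b) * x) * f x.
    by rewrite -(stein_ode hf x0 x1); ring.
  have h1 := hM _ x0 x1.
  have h2 : `|a - (a + b) * x| <= a + b by rewrite ler_norml; apply/andP; split; nra.
  have h3 : `|H x - H 0| <= L.
    by rewrite (le_trans (hH _ _))// subr0 gtr0_norm; nra.
  have h4 : `|(a - (a + b) * x) * f x| <= (a + b) * M by rewrite normrM ler_pM.
  rewrite (le_trans (ler_normB _ _))//.
  have := ler_normD (H x - H 0) (H 0); nra.
have : x * (1 - x) * `|df x| <= x * (1 - x) * (stein_factor a b * (L + (a + b) * M)).
  rewrite -[X in X * `|_|](gtr0_norm x01) -normrM (le_trans hb)//.
  rewrite mulrA ler_wpM2r//.
  apply: (@le_trans _ _ (x * (1 - x) * (8 * (a + b + 1) ^+ 2 / ((a + 1) * (b + 1))))).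
    rewrite mulrA ler_pdivlMr//; nra.
  by rewrite ler_pM2l// lerDr addr_ge0// mulr_ge0// ltW.
by rewrite ler_pM2l.
Qed.

End stein_bounds.

(** * The Stein equation of the derivative *)

Section shift.
Context {R : realType}.
Implicit Types (a b : R) (f df H dH : R -> R).

(** By the equation, |t|^(a+1) |f' t| is |t|^a |H t - (a - (a + b) t) f t| divided
    by |1 - t|, so the boundary condition of f carries over to f'. *)
Lemma stein_derive_boundary0 a b f df H (H0 : R) : 0 < a ->
  stein_equation a b f df H -> H t @[t --> (0 : R)^'] --> H0 ->
  `|t| `^ (a + 1) * df t @[t --> (0 : R)^'] --> (0 : R).
Proof.
move=> a0 hf hH.
have hid : t @[t --> (0 : R)^'] --> (0 : R) by exact: nbhs_dnbhs.
have hpow : `|t| `^ a @[t --> (0 : R)^'] --> (0 : R).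
  have h : `|t| @[t --> (0 : R)^'] --> (0 : R)^'+.
    move=> A [e /= e0 hA]; exists e => // t /=; rewrite sub0r normrN => te t0.
    by apply: hA; rewrite /= ?sub0r ?normrN ?normr_id// normr_gt0.
  exact: (cvg_comp _ _ h (powR_cvg0 a0)).
apply: norm_cvg0.
have h1 : `|(`|t| `^ a * H t - (a - (a + b) * t) * (`|t| `^ a * f t)) / (1 - t)|
    @[t --> (0 : R)^'] --> (0 : R).
  apply: (@cvg_eq_lim _ _ _ _ `|(0 * H0 - (a - (a + b) * 0) * 0) / (1 - 0)|).
    apply: cvg_norm; apply: cvgM; last first.
      by apply: cvgV; [rewrite subr0 oner_eq0|apply: cvgB => //; exact: cvg_cst].
    apply: cvgB; first exact: cvgM.
    apply: cvgM; last exact: stein_boundary0 hf.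
    by apply: cvgB; [exact: cvg_cst|apply: cvgM => //; exact: cvg_cst].
  by rewrite mul0r mulr0 subrr mul0r normr0.
apply: cvg_trans h1; apply: near_eq_cvg; near=> t.
have t0 : t != 0 by near: t; exact: nbhs_dnbhs_neq.
have t1 : t != 1.
  rewrite lt_eqF//; near: t; apply: nbhs_dnbhs.
  exact: lt_nbhsl.
have t1' : 1 - t != 0 by rewrite subr_eq0 eq_sym.
rewrite -(stein_ode hf t0 t1).
have -> : `|t| `^ (a + 1) = `|t| `^ a * `|t|.
  by rewrite powRD ?normr_eq0 ?t0 ?implybT// powRr1.
rewrite [RHS]normrM [in RHS]normrM normr_id -mulrA -!normrM; congr `|_|.
by field.
Unshelve. all: by end_near. Qed.

(** Differentiating the equation gives
      x (1 - x) f'' + (a + 1 - (a + b + 2) x) f' = H' + (a + b) f.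
    So f' solves the equation with parameters a + 1 and b + 1, and every estimate
    of first derivatives can be used once more for second derivatives. *)
Lemma stein_shift a b f df H dH (H0 H1 : R) : 0 < a -> 0 < b ->
  stein_equation a b f df H ->
  (forall x : R, x != 0 -> x != 1 -> is_derive x 1 H (dH x)) ->
  H t @[t --> (0 : R)^'] --> H0 -> H t @[t --> (1 : R)^'] --> H1 ->
  stein_equation (a + 1) (b + 1) df
    (fun x => (dH x + (a + b) * f x - (a + 1 - (a + 1 + (b + 1)) * x) * df x)
              / (x * (1 - x)))
    (fun x => dH x + (a + b) * f x).
Proof.
move=> a0 b0 hf hdH hH0 hH1; split.
- move=> x x0 x1.
  have x1' : 1 - x != 0 by rewrite subr_eq0 eq_sym.
  have xx : x * (1 - x) != 0 by rewrite mulf_neq0.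
  apply: (@is_derive_near _ (fun y => (H y - (a - (a + b) * y) * f y) / (y * (1 - y)))).
    near=> y.
    have y0 : y != 0 by near: y; exact: near_neq.
    have y1 : y != 1 by near: y; exact: near_neq.
    rewrite -(stein_ode hf y0 y1); field; rewrite y0/=.
    by rewrite subr_eq0 eq_sym y1.
  have h2 : is_derive x 1 (fun y => a - (a + b) * y) (- (a + b)).
    have := is_derive_affine a (- (a + b)) x.
    rewrite (_ : (fun t => _) = fun y => a - (a + b) * y)//.
    by apply/funext => t; rewrite mulNr.
  have h3 := is_derive_fun_mul (is_derive_id x (1 : R)) (is_derive_onem x).
  have h4 := is_derive_fun_add (hdH _ x0 x1)
     (is_derive_fun_opp (is_derive_fun_mul h2 (stein_derive hf x0 x1))).
  have h5 := is_derive_fun_mul h4 (@is_derive_fun_inv _ (fun y => y * (1 - y)) _ _ xx h3).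
  apply: (is_derive_eq h5); rewrite -(stein_ode hf x0 x1).
  by field; rewrite x0 x1'.
- move=> x x0 x1.
  have x1' : 1 - x != 0 by rewrite subr_eq0 eq_sym.
  by field; rewrite x0 x1'.
- exact: stein_derive_boundary0 hf hH0.
- have hH1' : H (1 - t) @[t --> (0 : R)^'] --> H1.
    by have := @cvg_dnbhs_onem R 0; rewrite subr0 => /cvg_comp; apply.
  have h := stein_derive_boundary0 b0 (stein_reflect hf) hH1'.
  have := @cvg_dnbhs_onem R 1; rewrite subrr => /cvg_comp /(_ h).
  apply: cvg_trans; apply: near_eq_cvg; apply: nearW => t.
  by rewrite /= subKr.
Unshelve. all: by end_near. Qed.

End shift.

(** * Mean value estimates and Taylor remainders *)

Section calculus.
Context {R : realType}.
Implicit Types (f df phi F : R -> R).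

(** By the mean value theorem the difference quotients at c are values of df near
    c. This is how a solution turns out to be differentiable at 0 and 1. *)
Lemma is_derive_of_limit f df (c l : R) : {for c, continuous f} ->
  (\forall t \near c^', is_derive (t : R) (1 : R) f (df t)) ->
  df t @[t --> c^'] --> l -> is_derive c 1 f l.
Proof.
move=> fc [d1 /= d10 hd] hl.
have key : (fun h : R => h^-1 *: ((f \o shift c) (h *: (1 : R)) - f c)) @ 0^' --> l.
  apply/cvgrPdist_le => e e0.
  have [d2 /= d20 hd2] := (cvgrPdist_le _ _).1 hl _ e0.
  have cont (x y : R) : x < y -> (forall z : R, x <= z <= y -> `|z - c| < d1) ->
      {within `[x, y], continuous f}.
    move=> xy hz; apply: continuous_in_subspaceT => z; rewrite inE/= in_itv/= => hzz.
    have [->|zc] := eqVneq z c; first exact: fc.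
    by apply: is_derive_continuous; apply: hd zc; rewrite /= distrC hz.
  exists (Num.min d1 d2) => /=; first by rewrite lt_min d10.
  move=> h /=; rewrite sub0r normrN lt_min => /andP[hd1 hd2'] h0.
  rewrite /GRing.scale/= mulr1.
  have [hneg|hpos] := ltP h 0.
    have hc : h + c < c by rewrite gtrDr.
    have hin (z : R) : h + c <= z <= c -> `|z - c| <= `|h|.
      move=> /andP[z1 z2]; rewrite (ler0_norm (ltW hneg)) ler0_norm ?subr_le0//; lra.
    have [||xi xii E] := @MVT _ f df _ _ hc.
    - move=> x; rewrite in_itv/= => /andP[x1 x2]; apply: hd.
        by rewrite /= distrC (le_lt_trans _ hd1)// hin// !ltW.
      by rewrite lt_eqF.
    - by apply: cont => // z /hin /le_lt_trans; apply.
    move: xii; rewrite in_itv/= => /andP[x1 x2].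
    have -> : h^-1 * (f (h + c) - f c) = df xi.
      by rewrite -[f (h + c) - f c]opprB E; field.
    apply: hd2; last by rewrite lt_eqF.
    by rewrite /= distrC (le_lt_trans _ hd2')// hin// !ltW.
  have hpos' : 0 < h by rewrite lt_def h0.
  have hc : c < h + c by rewrite ltrDr.
  have hin (z : R) : c <= z <= h + c -> `|z - c| <= `|h|.
    move=> /andP[z1 z2]; rewrite (gtr0_norm hpos') ger0_norm ?subr_ge0//; lra.
  have [||xi xii E] := @MVT _ f df _ _ hc.
  - move=> x; rewrite in_itv/= => /andP[x1 x2]; apply: hd.
      by rewrite /= distrC (le_lt_trans _ hd1)// hin// !ltW.
    by rewrite gt_eqF.
  - by apply: cont => // z /hin /le_lt_trans; apply.
  move: xii; rewrite in_itv/= => /andP[x1 x2].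
  have -> : h^-1 * (f (h + c) - f c) = df xi.
    by rewrite E; field.
  apply: hd2; last by rewrite gt_eqF.
  by rewrite /= distrC (le_lt_trans _ hd2')// hin// !ltW.
split; first by apply/cvg_ex; exists l.
by apply/cvg_lim => //.
Qed.

Lemma lipschitz_off01 phi dphi (K : R) : continuous phi ->
  (forall x : R, x != 0 -> x != 1 -> is_derive x 1 phi (dphi x)) ->
  (forall x : R, x != 0 -> x != 1 -> `|dphi x| <= K) ->
  forall x y, `|phi x - phi y| <= K * `|x - y|.
Proof.
move=> hc hd hK.
have base (x y : R) : x <= y -> (forall z : R, x < z < y -> z != 0 /\ z != 1) ->
    `|phi y - phi x| <= K * (y - x).
  rewrite le_eqVlt => /predU1P[-> _|xy hz]; first by rewrite !subrr normr0 mulr0.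
  have [||xi + ->] := @MVT _ phi dphi _ _ xy.
  - by move=> z; rewrite in_itv/= => /hz[]; exact: hd.
  - exact: continuous_subspaceT.
  rewrite in_itv/= => /hz[z0 z1].
  rewrite normrM (gtr0_norm (_ : 0 < y - x)) ?subr_gt0//.
  by rewrite ler_wpM2r ?subr_ge0 ?hK// ltW.
have le (x y : R) : x <= y -> `|phi y - phi x| <= K * (y - x).
  (* u and v are the projections of 0 and 1 on [x, y] *)
  move=> xy; pose u := Num.max x (Num.min 0 y); pose v := Num.max x (Num.min 1 y).
  have [xu uv vy] : [/\ x <= u, u <= v & v <= y].
    split; rewrite /u /v.
    - by rewrite le_max lexx.
    - by rewrite ge_max !le_max lexx/= le_min !ge_min lexx ler01 !orbT.
    - by rewrite ge_max xy ge_min lexx orbT.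
  have h1 := base _ _ xu; have h2 := base _ _ uv; have h3 := base _ _ vy.
  have {}h1 : `|phi u - phi x| <= K * (u - x).
    apply: h1 => z /andP[xz]; rewrite lt_max => /orP[/(lt_trans xz)|].
      by rewrite ltxx.
    by rewrite lt_min => /andP[z0 _]; split; rewrite lt_eqF// (lt_trans z0).
  have {}h2 : `|phi v - phi u| <= K * (v - u).
    apply: h2 => z /andP[]; rewrite gt_max => /andP[xz].
    rewrite gt_min lt_max => hz /orP[/(lt_trans xz)|]; first by rewrite ltxx.
    rewrite lt_min => /andP[z1 zy]; split; last by rewrite lt_eqF.
    by case/orP: hz => [z0|/(lt_trans zy)]; rewrite ?ltxx// gt_eqF.
  have {}h3 : `|phi y - phi v| <= K * (y - v).
    apply: h3 => z /andP[]; rewrite gt_max => /andP[_].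
    rewrite gt_min => /orP[z1 _|yz /(lt_trans yz)]; last by rewrite ltxx.
    by split; rewrite gt_eqF// (lt_trans _ z1).
  have -> : phi y - phi x = (phi y - phi v) + ((phi v - phi u) + (phi u - phi x)).
    by ring.
  rewrite (le_trans (ler_normD _ _))//.
  have := ler_normD (phi v - phi u) (phi u - phi x); lra.
move=> x y; have [xy|/ltW yx] := leP x y.
  by rewrite distrC (distrC x) (ger0_norm (_ : 0 <= y - x)) ?subr_ge0// le.
by rewrite (ger0_norm (_ : 0 <= x - y)) ?subr_ge0// le.
Qed.

(** Both w - u and w + u are nondecreasing. This yields Taylor remainders with the
    right constants without integrating the derivatives. *)
Lemma dominated_increment (u du w dw : R -> R) :
  (forall s : R, 0 <= s <= 1 -> is_derive s 1 u (du s)) ->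
  (forall s : R, 0 <= s <= 1 -> is_derive s 1 w (dw s)) ->
  (forall s : R, 0 <= s <= 1 -> `|du s| <= dw s) ->
  `|u 1 - u 0| <= w 1 - w 0.
Proof.
move=> hu hw hle.
have main (g dg : R -> R) : (forall s : R, 0 <= s <= 1 -> is_derive s 1 g (dg s)) ->
    (forall s : R, 0 <= s <= 1 -> 0 <= dg s) -> g 0 <= g 1.
  move=> hg hdg; have [||c + E] := @MVT _ g dg _ _ (@ltr01 R).
  - by move=> x /subset_itv_oo_cc; rewrite in_itv/=; exact: hg.
  - apply: continuous_in_subspaceT => x; rewrite inE/= in_itv/= => /hg.
    exact: is_derive_continuous.
  move=> /subset_itv_oo_cc; rewrite in_itv/= => hc01.
  by rewrite -subr_ge0 E subr0 mulr1 hdg.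
have h1 : w 0 - u 0 <= w 1 - u 1.
  apply: (main (fun s => w s - u s) (fun s => dw s - du s)).
  - by move=> s hs; apply: is_derive_fun_add; [exact: hw|apply: is_derive_fun_opp; exact: hu].
  - by move=> s hs; rewrite subr_ge0 (le_trans (ler_norm _))// hle.
have h2 : w 0 + u 0 <= w 1 + u 1.
  apply: (main (fun s => w s + u s) (fun s => dw s + du s)).
  - by move=> s hs; apply: is_derive_fun_add; [exact: hw|exact: hu].
  - move=> s hs; have := hle _ hs; rewrite ler_norml => /andP[h _]; lra.
rewrite ler_norml; apply/andP; split; lra.
Qed.

Lemma is_derive_segment f df (x h s : R) :
  (forall t : R, is_derive t 1 f (df t)) ->
  is_derive s 1 (fun t => f (x + h * t)) (h * df (x + h * s)).
Proof.
move=> hf; apply: (@is_derive_fun_comp _ f (fun t => x + h * t)) => //.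
exact: is_derive_affine.
Qed.

Lemma taylor1 f phi (K x h : R) :
  (forall t : R, is_derive t 1 f (phi t)) ->
  (forall s t, `|phi s - phi t| <= K * `|s - t|) ->
  `|f (x + h) - f x - phi x * h| <= K / 2 * h ^+ 2.
Proof.
move=> hf hphi.
pose u s := f (x + h * s) + (- (phi x * h)) * s.
pose du s := h * phi (x + h * s) - phi x * h.
pose w s := K / 2 * h ^+ 2 * (s * s).
pose dw s := K * h ^+ 2 * s.
have := @dominated_increment u du w dw.
rewrite /u /w !mulr0 !mulr1 !addr0 subr0 addrAC; apply.
- move=> s _; apply: is_derive_fun_add; first exact: is_derive_segment.
  by have := is_derive_affine 0 (- (phi x * h)) s; under eq_fun do rewrite add0r.
- move=> s _; rewrite /dw.
  have h1 := is_derive_fun_mul (is_derive_id s (1 : R)) (is_derive_id s (1 : R)).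
  have h2 := is_derive_fun_mul (is_derive_cst (K / 2 * h ^+ 2) s (1 : R)) h1.
  by apply: (is_derive_eq h2); rewrite /cst; field.
- move=> s /andP[s0 s1]; rewrite /du /dw mulrC -mulrBl normrM.
  have := hphi (x + h * s) x; rewrite addrAC subrr add0r normrM (ger0_norm s0).
  move=> /(ler_wpM2r (normr_ge0 h)) /le_trans; apply.
  by rewrite -(real_normK (num_real h)); rewrite le_eqVlt; apply/orP; left; apply/eqP; ring.
Qed.

Lemma taylor2 F f phi (K x h : R) :
  (forall t : R, is_derive t 1 F (f t)) ->
  (forall t : R, is_derive t 1 f (phi t)) ->
  (forall s t, `|phi s - phi t| <= K * `|s - t|) ->
  `|F (x + h) - F x - f x * h - phi x * h ^+ 2 / 2| <= K / 6 * `|h| ^+ 3.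
Proof.
move=> hF hf hphi.
pose u s := F (x + h * s) + (- (f x * h) * s + - (phi x * h ^+ 2 / 2) * (s * s)).
pose du s := h * f (x + h * s) + (- (f x * h) - phi x * h ^+ 2 * s).
pose w s := K / 6 * `|h| ^+ 3 * (s * (s * s)).
pose dw s := K / 2 * `|h| ^+ 3 * s ^+ 2.
have := @dominated_increment u du w dw.
have -> : u 1 - u 0 = F (x + h) - F x - f x * h - phi x * h ^+ 2 / 2.
  by rewrite /u !mulr0 !mulr1 !addr0; ring.
have -> : w 1 - w 0 = K / 6 * `|h| ^+ 3 by rewrite /w !mulr0 !mulr1 subr0.
have sq s := is_derive_fun_mul (is_derive_id s (1 : R)) (is_derive_id s (1 : R)).
apply.
- move=> s _; apply: is_derive_fun_add; first exact: is_derive_segment.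
  have h1 := is_derive_affine 0 (- (f x * h)) s.
  have h2 := is_derive_fun_mul (is_derive_cst (- (phi x * h ^+ 2 / 2)) s (1 : R)) (sq s).
  have := is_derive_fun_add h1 h2; under eq_fun do rewrite add0r.
  by move=> h3; apply: (is_derive_eq h3); rewrite /cst/=; field.
- move=> s _; rewrite /dw.
  have h2 := is_derive_fun_mul (is_derive_cst (K / 6 * `|h| ^+ 3) s (1 : R))
    (is_derive_fun_mul (is_derive_id s (1 : R)) (sq s)).
  by apply: (is_derive_eq h2); rewrite /cst/=; field.
- move=> s /andP[s0 s1].
  have -> : du s = h * (f (x + h * s) - f x - phi x * (h * s)) by rewrite /du; ring.
  rewrite normrM; have /(ler_wpM2l (normr_ge0 h)) := taylor1 x (h * s) hf hphi.
  move=> /le_trans; apply; rewrite /dw.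
  rewrite -(real_normK (num_real (h * s))) normrM (ger0_norm s0).
  by rewrite le_eqVlt; apply/orP; left; apply/eqP; ring.
Qed.

End calculus.

(** * Essential suprema and integration against a density *)

Section essential_norm.
Context {R : realType}.
Local Notation mu := (@lebesgue_measure R).
Implicit Types (f : R -> R).

Lemma ess_normP f (K : R) :
  (ess_norm f <= K%:E)%E <-> {ae mu, forall x, `|f x| <= K}.
Proof.
rewrite /ess_norm unlock.
have -> : (0 < mu [set: R])%E.
  apply: (@lt_le_trans _ _ (mu `[0, 1])).
    by rewrite lebesgue_measure_itv/= lte_fin ltr01 -EFinB subr0 lte_fin ltr01.
  by apply: le_measure; rewrite ?inE.
by split => [/ess_supP|h]; [|apply/ess_supP].
Qed.

Lemma ess_norm_off01 f (K : R) :
  (forall x, x != 0 -> x != 1 -> `|f x| <= K) -> (ess_norm f <= K%:E)%E.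
Proof.
move=> hK; apply/ess_normP; exists ([set 0] `|` [set 1]); split.
- by apply: measurableU; exact: measurable_set1.
- by rewrite null_set_setU//; exact: lebesgue_measure_set1.
- move=> x /= hx; have [->|x0] := eqVneq x 0; first by left.
  by have [->|x1] := eqVneq x 1; [right|case: hx; exact: hK].
Qed.

(** A value above K at a point of continuity would give values above K on a ball,
    which has positive measure. *)
Lemma ess_norm_continuous f (K x : R) : (ess_norm f <= K%:E)%E ->
  {for x, continuous f} -> `|f x| <= K.
Proof.
move=> /ess_normP [N [mN N0 hN]] fx; rewrite leNgt; apply/negP => Kfx.
have : \forall y \near x, K < `|f y|.
  have : `|f y| @[y --> x] --> `|f x| by apply: cvg_norm; exact: fx.
  by move=> /cvgr_gt; apply.
move=> [e /= e0 he].
have : (mu (ball x e) <= mu N)%E.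
  apply: le_measure; rewrite ?inE//; first exact: measurable_ball.
  by move=> y /he Ky; apply: hN => /=; apply/negP; rewrite -ltNge.
rewrite N0 (lebesgue_measure_ball _ (ltW e0)) => he2.
by have : e *+ 2 <= 0 by []; rewrite leNgt mulrn_wgt0.
Qed.

Lemma ess_norm_ge0 f : (0 <= ess_norm f)%E.
Proof. exact: Lnorm_ge0. Qed.

End essential_norm.

Section density.
Local Open Scope ereal_scope.
Context d (T : measurableType d) (R : realType).
Variables (mu nu : {measure set T -> \bar R}) (q : T -> R).
Hypotheses (q0 : forall x, (0 <= q x)%R) (mq : measurable_fun setT q).
Hypothesis nuE : forall A, measurable A -> nu A = \int[mu]_(x in A) (q x)%:E.

Import HBNNSimple.

Let ge0_integral_density (f : T -> \bar R) : (forall x, 0 <= f x) ->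
  measurable_fun setT f -> \int[nu]_x f x = \int[mu]_x (f x * (q x)%:E).
Proof.
move=> f0 mf; pose h := nnsfun_approx measurableT mf.
have cf x : (h n x)%:E @[n --> \oo] --> f x by exact: cvg_nnsfun_approx.
have nd x m n : (m <= n)%N -> ((h m x)%:E <= (h n x)%:E).
  by move=> mn; rewrite lee_fin; exact/lefP/nd_nnsfun_approx.
have mh n : measurable_fun setT (EFin \o h n) by exact/measurable_EFinP.
have mqE : measurable_fun setT (EFin \o q) by exact/measurable_EFinP.
transitivity (limn (fun n => \int[nu]_x (h n x)%:E)).
  rewrite -monotone_convergence//.
  - by apply: eq_integral => x _; apply/esym/cvg_lim.
  - by move=> n x _; rewrite lee_fin.
  - by move=> x _ m n; exact: nd.
transitivity (limn (fun n => \int[mu]_x ((h n x)%:E * (q x)%:E))); last first.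
  rewrite -monotone_convergence//.
  - by apply: eq_integral => x _; apply/cvg_lim => //; exact: cvgeZr.
  - by move=> n; apply: emeasurable_funM; [exact: mh|exact: mqE].
  - by move=> n x _; rewrite mule_ge0 ?lee_fin.
  - by move=> x _ m n mn; rewrite lee_wpmul2r ?lee_fin// -lee_fin nd.
congr (limn _); apply/funext => n.
pose ind y x : R := (y * \1_(h n @^-1` [set y]) x)%R.
have ind0 y x : (0 <= ind y x)%R.
  by rewrite -lee_fin; exact: nnfun_muleindic_ge0.
have mind y : measurable_fun setT (ind y) by exact: measurable_funM.
transitivity (\int[nu]_x (\sum_(y \in range (h n)) (ind y x)%:E)).
  by apply: eq_integral => x _; rewrite fimfunE -fsumEFin.
transitivity (\int[mu]_x (\sum_(y \in range (h n)) ((ind y x)%:E * (q x)%:E))); last first.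
  apply: eq_integral => x _; rewrite fimfunE -fsumEFin// ge0_mule_fsuml//.
  by move=> y; rewrite lee_fin; exact: (ind0 y x).
rewrite !ge0_integral_fsum//; last 4 first.
- by move=> y; apply: emeasurable_funM => //; exact/measurable_EFinP.
- by move=> y x _; rewrite mule_ge0 ?lee_fin.
- by move=> y; exact/measurable_EFinP.
- by move=> y x _; rewrite lee_fin.
apply: eq_fsbigr => y yr; rewrite /ind.
have y0 : (0 <= y)%R by move: yr; rewrite inE => -[x _ <-].
have mA : measurable (h n @^-1` [set y]) by [].
under eq_integral do rewrite EFinM.
under [RHS]eq_integral do rewrite EFinM -muleA.
rewrite ge0_integralZl_EFin//; last first.
  by apply/measurable_EFinP; exact: measurable_indic.
rewrite ge0_integralZl_EFin//; last 2 first.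
- by move=> x _; rewrite mule_ge0 ?lee_fin.
- by apply: emeasurable_funM => //; apply/measurable_EFinP; exact: measurable_indic.
rewrite integral_indic// setIT nuE//; congr (_ * _).
rewrite integral_mkcond/=; apply: eq_integral => x _; rewrite patchE indicE.
by case: ifP => _; rewrite ?mul1e ?mul0e.
Qed.

(** Nonnegative functions are increasing limits of simple functions; as q is
    nonnegative, multiplication by q commutes with positive and negative parts,
    so the identity also holds when f is not integrable. *)
Lemma integral_density (f : T -> \bar R) : measurable_fun setT f ->
  \int[nu]_x f x = \int[mu]_x (f x * (q x)%:E).
Proof.
move=> mf; rewrite integralE [RHS]integralE.
congr (_ - _); rewrite ge0_integral_density//; try exact: measurable_funepos;
  try exact: measurable_funeneg; apply: eq_integral => x _; rewrite ?funeposE ?funenegE.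
- by rewrite maxeMl ?mul0e ?lee_fin.
- by rewrite -mulNe maxeMl ?mul0e ?lee_fin.
Qed.

End density.

(** * Antiderivatives of integrable functions *)

Section antiderivative.
Context {R : realType}.
Local Notation mu := (@lebesgue_measure R).
Implicit Types (g : R -> R) (x y z : R).

Lemma Rintegral_itv_cat g x y z : x <= y -> y <= z ->
  mu.-integrable `[x, z] (EFin \o g) ->
  \int[mu]_(t in `[x, z]) g t =
  \int[mu]_(t in `[x, y]) g t + \int[mu]_(t in `[y, z]) g t.
Proof.
move=> xy yz ig.
have := @Rintegral_itvB _ g (BLeft x) (BRight z) y ig.
rewrite !bnd_simp => /(_ xy yz)/eqP; rewrite subr_eq => /eqP ->.
rewrite Rintegral_itv_obnd_cbnd 1?addrC//.
apply: integrableS ig => //=; apply: subset_itvr.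
by rewrite bnd_simp.
Qed.

Lemma integrable_itv_cat g x y z :
  mu.-integrable `[x, y] (EFin \o g) -> mu.-integrable `[y, z] (EFin \o g) ->
  mu.-integrable `[x, z] (EFin \o g).
Proof.
move=> ixy iyz.
have [xy|xy] := leP x y; last first.
  by apply: integrableS iyz => //=; apply: subset_itvr; rewrite bnd_simp ltW.
have [yz|yz] := leP y z; last first.
  by apply: integrableS ixy => //=; apply: subset_itvl; rewrite bnd_simp ltW.
have ixy' : mu.-integrable `[x, y[ (EFin \o g).
  by apply: integrableS ixy => //=; apply: subset_itvl; rewrite bnd_simp.
rewrite (@itv_bndbnd_setU _ _ _ (BLeft y)) ?bnd_simp//.
have mg : measurable_fun (`[x, y[ `|` `[y, z]) (EFin \o g).
  by apply/measurable_funU => //; split; [exact: measurable_int ixy'|exact: measurable_int iyz].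
apply/integrableP; split => //; rewrite ge0_integral_setU//=.
- by apply: lte_add_pinfty; [case/integrableP : ixy'|case/integrableP : iyz].
- by apply/measurable_EFinP; apply: measurableT_comp => //; exact/measurable_EFinP.
- apply/disj_set2P; rewrite -subset0 => t/=; rewrite !in_itv/=.
  by move=> [/andP[_ ty] /andP[yt _]]; move: (lt_le_trans ty yt); rewrite ltxx.
Qed.

Lemma measurable_fun_off2 g x y :
  (forall t, t != x -> t != y -> {for t, continuous g}) -> measurable_fun setT g.
Proof.
move=> gc; pose U := ~` [set x; y].
have -> : [set: R] = U `|` ([set x] `|` [set y]) by rewrite /U setvU.
have oU : open U.
  rewrite /U setCU; apply: openI.
    by rewrite (_ : ~` _ = [set t | t != x]); [exact: open_neq|
      apply/seteqP; split => t /= /eqP].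
  by rewrite (_ : ~` _ = [set t | t != y]); [exact: open_neq|
      apply/seteqP; split => t /= /eqP].
apply/measurable_funU; first exact: open_measurable.
  exact: measurableU.
split; last by apply/measurable_funU => //; split; exact: measurable_fun_set1.
apply: open_continuous_measurable_fun => // t.
by rewrite inE /U /= => /not_orP[/eqP tx /eqP ty]; exact: gc.
Qed.

(** Local integrability suffices for continuity of J, including at points where g
    is unbounded; the integrands below are singular at 0 and 1. *)
Lemma antiderivative_exists g :
  (forall x y, mu.-integrable `[x, y] (EFin \o g)) ->
  exists J : R -> R, [/\ continuous J,
    forall x, {for x, continuous g} -> is_derive x 1 J (g x) &
    forall x y, x <= y -> J y - J x = \int[mu]_(t in `[x, y]) g t].
Proof.
move=> ig.
pose J x := if 0 <= x then \int[mu]_(t in `[0, x]) g t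
            else - \int[mu]_(t in `[x, 0]) g t.
have JB x y : x <= y -> J y - J x = \int[mu]_(t in `[x, y]) g t.
  move=> xy; rewrite /J; case: (leP 0 x) => x0; case: (leP 0 y) => y0.
  - by rewrite (Rintegral_itv_cat x0 xy)// addrC addKr.
  - by move: (lt_le_trans y0 x0); rewrite ltNge xy.
  - by rewrite opprK (Rintegral_itv_cat (ltW x0) y0)// addrC.
  - by rewrite (Rintegral_itv_cat xy (ltW y0))// opprK addrC addrK.
pose K c y := \int[mu]_(t in `[c, y]) g t.
have JK x : \forall y \near x, J (x - 1) + K (x - 1) y = J y.
  near=> y; rewrite /K -JB ?subrKC//.
  by apply/ltW; near: y; apply: lt_nbhsr; rewrite ltrBlDr ltrDl.
have x1 x : x - 1 < x + 1 by lra.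
have xin x : x \in `](x - 1), (x + 1)[ by rewrite in_itv/=; lra.
exists J; split => //.
- move=> x; have := @parameterized_integral_continuous _ _ _ g (ltW (x1 x)) (ig _ _).
  move=> /(continuous_within_itvP _ (x1 x))[+ _ _] => /(_ _ (xin x)) h.
  rewrite /continuous_at -(nbhs_singleton (JK x)).
  apply: cvg_trans (cvgD (cvg_cst (J (x - 1))) h).
  by apply: near_eq_cvg; exact: JK.
- move=> x gx.
  have xl : x - 1 < x by lra.
  have xr : x < x + 1 by lra.
  have [h1 h2] := @continuous_FTC1_closed _ g (x - 1) x (x + 1) xr (ig _ _) xl gx.
  apply: (is_derive_near (JK x)); rewrite -[g x]add0r.
  apply: is_derive_fun_add; rewrite -h2 derive1E; exact: derivableP.
Unshelve. all: by end_near. Qed.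

(** Exhausting the open interval by compact ones, where the fundamental theorem of
    calculus applies, bounds the integral of r by P d - P c. It shows that a
    singularity at an endpoint is integrable. *)
Lemma integrable_of_antiderivative (r P : R -> R) (c d : R) : c < d ->
  measurable_fun setT r -> (forall t, 0 <= r t) ->
  {in `]c, d[, continuous r} -> continuous P ->
  (forall t, c < t < d -> is_derive t 1 P (r t)) ->
  mu.-integrable `[c, d] (EFin \o r).
Proof.
move=> cd mr r0 cr cP dP.
apply/integrableP; split; first exact/measurable_EFinP/measurable_funTS.
have mrE : measurable_fun setT (EFin \o r) by exact/measurable_EFinP.
under eq_integral do rewrite gee0_abs ?lee_fin//.
rewrite (@integral_itv_bndoo _ _ _ (EFin \o r) true false); last exact: measurable_funTS.
have mono x y : c <= x -> x <= y -> y <= d -> P x <= P y.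
  move=> cx xy yd; have [||xi + E] := @MVT_segment _ P r _ _ xy.
  - move=> z; rewrite in_itv/= => /andP[z1 z2]; apply: dP.
    by rewrite (le_lt_trans cx)// (lt_le_trans z2).
  - exact: continuous_subspaceT.
  by move=> _; rewrite -subr_ge0 E mulr_ge0// subr_ge0.
have dc3 : 0 < (d - c) / 3 by rewrite divr_gt0// subr_gt0.
(* with the factor 1/3 the n-th interval [c + e n, d - e n] is never degenerate *)
pose e n := (d - c) / 3 * n.+1%:R^-1.
have e0 n : 0 < e n by rewrite /e mulr_gt0.
have e1 n : e n <= (d - c) / 3.
  by rewrite /e ler_piMr ?(ltW dc3)// invf_le1 ?ler1n ?ltr0n.
pose F n := `[c + e n, d - e n]%classic.
have UF : \bigcup_n F n = `]c, d[%classic.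
  apply/seteqP; split => [t [n _]|t]; rewrite /F/= !in_itv/=.
    by have := e0 n; lra.
  move=> /andP[ct td]; pose m := Num.min (t - c) (d - t).
  have m0 : 0 < m by rewrite lt_min !subr_gt0 ct.
  have [n hn] : exists n, e n <= m.
    have [n] := ltr_add_invr (divr_gt0 m0 dc3); rewrite add0r => hn; exists n.
    by rewrite /e mulrC -ler_pdivlMr// ltW.
  exists n => //=; rewrite in_itv/=; move: hn; rewrite le_min; lra.
have nd : nondecreasing_seq F.
  move=> m n mn; apply/subsetPset => t; rewrite /F/= !in_itv/=.
  suff : e n <= e m by lra.
  by rewrite /e ler_wpM2l ?(ltW dc3)// lef_pV2 ?posrE// ler_nat ltnS.
have mF n : measurable (F n) by exact: measurable_itv.
have hc : (\int[mu]_(x in F n) (r x)%:E)%E @[n --> \oo] -->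
    (\int[mu]_(x in `]c, d[) (r x)%:E)%E.
  rewrite -UF; apply: ge0_nondecreasing_set_cvg_integral => //.
  - by move=> n; exact: measurable_funTS.
  - by move=> n x _; rewrite lee_fin.
rewrite -(cvg_lim _ hc)//.
apply: (@le_lt_trans _ _ (P d - P c)%:E); last exact: ltry.
apply: lime_le.
  apply: ereal_nondecreasing_is_cvgn.
  apply: ge0_nondecreasing_set_nondecreasing_integral => //.
  - by move=> n; exact: measurable_funTS.
  - by move=> n x _; rewrite lee_fin.
apply: nearW => n; rewrite /F.
have len : c + e n < d - e n by have := e1 n; lra.
have ein t : c + e n <= t <= d - e n -> c < t < d by have := e0 n; lra.
rewrite (@continuous_FTC2 _ r P _ _ len).
- rewrite -EFinB lee_fin lerD ?lerN2 ?mono//; have := e0 n; lra.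
- apply: continuous_in_subspaceT => t; rewrite inE/= in_itv/= => /ein ht.
  by apply: cr; rewrite in_itv.
- split => [t||].
  + rewrite in_itv/= => /andP[t1 t2]; apply: ex_derive; apply: dP.
    by apply: ein; rewrite !ltW.
  + by apply: cvg_at_right_filter; exact: cP.
  + by apply: cvg_at_left_filter; exact: cP.
- move=> t; rewrite in_itv/= => /andP[t1 t2].
  by apply: is_derive_derive1; apply: dP; apply: ein; rewrite !ltW.
Qed.

End antiderivative.

(** * Almost everywhere bounded derivatives, power singularities *)

Section bounded_derivative.
Context {R : realType}.
Local Notation mu := (@lebesgue_measure R).

Lemma is_derive_cvg_seq (f : R -> R) (x df : R) : is_derive x 1 f df ->
  n.+1%:R * (f (x + n.+1%:R^-1) - f x) @[n --> \oo] --> df.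
Proof.
move=> [hd hv].
have h0 : (n.+1%:R^-1 : R) @[n --> \oo] --> (0 : R)^'.
  have := @cvg_harmonic R => hh A [e /= e0 hA].
  suff : \forall n \near \oo, A (n.+1%:R^-1) by [].
  near=> n; apply: hA => /=; last by rewrite gt_eqF// invr_gt0.
  near: n; move/cvgrPdist_lt : hh; exact.
have hl : (fun h : R => h^-1 *: ((f \o shift x) (h *: (1 : R)) - f x)) @ 0^' --> df.
  by rewrite -hv; exact: hd.
have := cvg_comp _ _ h0 hl; apply: cvg_trans; apply: near_eq_cvg.
by apply: nearW => n /=; rewrite invrK /GRing.scale/= mulr1 (addrC x).
Unshelve. all: by end_near. Qed.

(** As dg need not be continuous, g is not an antiderivative of a continuous
    function. But the difference quotients k n of g are continuous, with the
    difference quotients Q n of an antiderivative G of g as antiderivatives; they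
    are bounded by M and tend to dg. By dominated convergence g y - g x is the
    integral of dg over [x, y], which ignores null sets. *)
Lemma lipschitz_of_ae_bound (g dg : R -> R) (M K : R) :
  (forall x : R, is_derive x 1 g (dg x)) -> (forall x : R, `|dg x| <= M) ->
  {ae mu, forall x, `|dg x| <= K} ->
  forall x y, `|g x - g y| <= K * `|x - y|.
Proof.
move=> hg hM hK.
have gc : continuous g by move=> x; exact: is_derive_continuous (hg x).
have gM := lipschitz_off01 gc (fun x _ _ => hg x) (fun x _ _ => hM x).
have [|G [Gc dG _]] := @antiderivative_exists _ g.
  move=> x y; apply: continuous_compact_integrable; first exact: segment_compact.
  exact: continuous_subspaceT.
pose k n t := n.+1%:R * (g (t + n.+1%:R^-1) - g t).
pose Q n t := n.+1%:R * (G (t + n.+1%:R^-1) - G t).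
have shiftc (f : R -> R) (df c t : R) : is_derive (t + c) 1 f df ->
    is_derive t 1 (fun s => f (s + c)) df.
  move=> h; have := @is_derive_fun_comp _ f (fun s => s + c) t df 1 h.
  rewrite mul1r; apply; have := is_derive_affine c 1 t.
  by rewrite (_ : (fun _ => _) = fun s => s + c)//; apply/funext => s; rewrite mul1r addrC.
have dQ n (t : R) : is_derive t 1 (Q n) (k n t).
  apply: (@is_derive_eq _ _ _ _ _ _ _ (0 * (G (t + n.+1%:R^-1) - G t) + k n t)).
    apply: (is_derive_fun_mul (is_derive_cst (n.+1%:R : R) t (1 : R))).
    apply: is_derive_fun_add; first by apply: shiftc; apply: dG; exact: gc.
    by apply: is_derive_fun_opp; apply: dG; exact: gc.
  by rewrite mul0r add0r.
have kc n : continuous (k n).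
  move=> t; apply: cvgM; first exact: cvg_cst.
  apply: cvgB; last exact: gc.
  by apply: is_derive_continuous; exact: shiftc (hg _).
have kM n t : `|k n t| <= M.
  rewrite /k normrM ger0_norm// -ler_pdivlMl// (le_trans (gM _ _))//.
  by rewrite addrAC subrr add0r ger0_norm ?invr_ge0// mulrC.
have kl t : k n t @[n --> \oo] --> dg t by exact: is_derive_cvg_seq.
have mk n : measurable_fun setT (k n) by exact: continuous_measurable_fun.
have mdg : measurable_fun setT dg.
  by apply: (@measurable_fun_cvg _ _ _ setT k) => // t _; exact: kl.
have main x y : x < y -> `|g y - g x| <= K * (y - x).
  move=> xy.
  have Qint n : (\int[mu]_(t in `[x, y]) (k n t)%:E = (Q n y - Q n x)%:E)%E.
    rewrite (@continuous_FTC2 _ (k n) (Q n))//.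
    - exact: continuous_subspaceT.
    - split => [t _||].
      + by apply: ex_derive; exact: dQ.
      + by apply: cvg_at_right_filter; apply: is_derive_continuous (dQ n x).
      + by apply: cvg_at_left_filter; apply: is_derive_continuous (dQ n y).
    - by move=> t _; exact: is_derive_derive1 (dQ n t).
  have icst c : mu.-integrable `[x, y] (cst c%:E).
    apply: continuous_compact_integrable; first exact: segment_compact.
    by apply: continuous_subspaceT => t; exact: cvg_cst.
  have mdgE : measurable_fun `[x, y] (EFin \o dg).
    by apply/measurable_funTS/measurable_EFinP.
  have [idg _ hcv] : [/\ mu.-integrable `[x, y] (EFin \o dg),
      (\int[mu]_(t in `[x, y]) `|(k n t)%:E - (dg t)%:E|)%E @[n --> \oo] --> 0%E &
      (\int[mu]_(t in `[x, y]) (k n t)%:E)%E @[n --> \oo] -->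
      (\int[mu]_(t in `[x, y]) (dg t)%:E)%E].
    apply: (@dominated_convergence _ _ _ mu `[x, y] _ (fun n t => (k n t)%:E)
      (EFin \o dg) (cst M%:E)) => //.
    - by move=> n; apply/measurable_EFinP; apply: measurable_funTS; exact: mk.
    - by apply: aeW => t _; apply: cvg_EFin; [exact: nearW|exact: kl].
    - by apply: aeW => t n _; rewrite lee_fin.
  have hlim : (Q n y - Q n x)%:E @[n --> \oo] --> (g y - g x)%:E.
    apply: cvg_EFin; first exact: nearW.
    by apply: cvgB; apply: is_derive_cvg_seq; apply: dG; exact: gc.
  have E : (\int[mu]_(t in `[x, y]) (dg t)%:E = (g y - g x)%:E)%E.
    move: hcv; under eq_cvg do rewrite Qint.
    by move=> /(cvg_unique _ hlim) <-.
  rewrite -lee_fin -[leLHS]/(`|(g y - g x)%:E|)%E -E.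
  apply: (le_trans (le_abse_integral mu _ mdgE)) => //.
  have -> : (K * (y - x))%:E = (\int[mu]_(t in `[x, y]) K%:E)%E.
    by rewrite integral_cst//= lebesgue_measure_itv/= lte_fin xy EFinM.
  have [N [mN N0 hN]] := hK.
  have K0 : 0 <= K.
    rewrite leNgt; apply/negP => Kneg.
    have : (mu `[x, y] <= mu N)%E.
      apply: le_measure; rewrite ?inE// => t _; apply: hN => /= ht.
      by move: (le_lt_trans ht Kneg); rewrite ltNge normr_ge0.
    by rewrite N0 lebesgue_measure_itv/= lte_fin xy -EFinB lee_fin leNgt subr_gt0 xy.
  apply: ae_ge0_le_integral => //.
  - exact: measurableT_comp.
  - exists N; split => // t /= ht; apply: hN => /= h; apply: ht => _.
    by rewrite lee_fin.
move=> x y; have [xy|yx|->] := ltgtP x y.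
- by rewrite distrC (distrC x) (gtr0_norm (_ : 0 < y - x)) ?subr_gt0// main.
- by rewrite (gtr0_norm (_ : 0 < x - y)) ?subr_gt0// main.
- by rewrite !subrr normr0 mulr0.
Qed.

End bounded_derivative.

Section power_singularity.
Context {R : realType}.
Local Notation mu := (@lebesgue_measure R).

Lemma continuous_norm_powR (a : R) : 0 < a -> continuous (fun t : R => `|t| `^ a).
Proof.
move=> a0 t; have [->|t0] := eqVneq t 0.
  apply/cvgrPdist_lt => e e0; rewrite normr0 powR0 ?gt_eqF//.
  have [d /= d0 hd] := (cvgrPdist_lt _ _).1 (powR_cvg0 a0) _ e0.
  exists d => // s /= sd; have [->|s0] := eqVneq s 0.
    by rewrite normr0 powR0 ?gt_eqF// subrr normr0.
  apply: hd; last by rewrite normr_gt0.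
  by rewrite /= sub0r normrN normr_id -normrN -sub0r.
have := is_derive_continuous (is_derive_powR a (_ : 0 < `|t|)).
rewrite normr_gt0 => /(_ t0) h.
by apply: (@continuous_comp _ _ _ (fun s : R => `|s|) (fun s => s `^ a)) => //; exact: norm_continuous.
Qed.

(** The power |t - e|^(a-1) has the antiderivatives |t - e|^a / a to the right of e
    and - |t - e|^a / a to the left of e, which are continuous at e. *)
Lemma integrable_power_singularity (a e x y : R) : 0 < a ->
  mu.-integrable `[x, y] (fun t => (`|t - e| `^ a / `|t - e|)%:E).
Proof.
move=> a0.
have r0 (t : R) : 0 <= `|t - e| `^ a / `|t - e| by rewrite divr_ge0// powR_ge0.
have cr (t : R) : t != e -> {for t, continuous (fun t : R => `|t - e| `^ a / `|t - e|)}.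
  move=> te.
  have h : {for t, continuous (fun t : R => `|t - e|)}.
    by apply: cvg_norm; apply: cvgB => //; exact: cvg_cst.
  apply: cvgM; last by apply: cvgV => //; rewrite normr_eq0 subr_eq0.
  apply: (@continuous_comp _ _ _ (fun t => t - e) (fun t => `|t| `^ a)).
    by apply: cvgB => //; exact: cvg_cst.
  exact: continuous_norm_powR.
have mr : measurable_fun setT (fun t : R => `|t - e| `^ a / `|t - e|).
  by apply: (@measurable_fun_off2 _ _ e e) => t te _; exact: cr.
have cP : continuous (fun t : R => `|t - e| `^ a / a).
  move=> t; apply: cvgM; last exact: cvg_cst.
  apply: (@continuous_comp _ _ _ (fun t => t - e) (fun t => `|t| `^ a)).
    by apply: cvgB => //; exact: cvg_cst.
  exact: continuous_norm_powR.
have right z : e < z -> mu.-integrable `[e, z] (fun t => (`|t - e| `^ a / `|t - e|)%:E).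
  move=> ez; apply: (integrable_of_antiderivative ez mr r0 _ cP).
    by move=> t; rewrite in_itv/= => /andP[et _]; apply: cr; rewrite gt_eqF.
  move=> t /andP[et _]; have te : 0 < t - e by rewrite subr_gt0.
  apply: (@is_derive_near _ (fun t => (t - e) `^ a * a^-1)).
    near=> s; rewrite ger0_norm// subr_ge0 ltW//; near: s; exact: lt_nbhsr.
  have h1 : is_derive t 1 (fun s => s - e) 1.
    have := is_derive_affine (- e) 1 t.
    by rewrite (_ : (fun _ => _) = fun s => s - e)//; apply/funext => s; rewrite mul1r addrC.
  have h2 := @is_derive_fun_comp _ (fun s => s `^ a) (fun s => s - e) _ _ _
     (is_derive_powR a te) h1.
  have h3 := is_derive_fun_mul h2 (is_derive_cst a^-1 t (1 : R)).
  apply: (is_derive_eq h3); rewrite (gtr0_norm te) /cst; field.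
  by rewrite !gt_eqF.
have left z : z < e -> mu.-integrable `[z, e] (fun t => (`|t - e| `^ a / `|t - e|)%:E).
  have cP' : continuous (fun t : R => - (`|t - e| `^ a / a)).
    by move=> t; apply: cvgN; exact: cP.
  move=> ez; apply: (integrable_of_antiderivative ez mr r0 _ cP').
    by move=> t; rewrite in_itv/= => /andP[_ te]; apply: cr; rewrite lt_eqF.
  move=> t /andP[_ et]; have te : 0 < e - t by rewrite subr_gt0.
  apply: (@is_derive_near _ (fun t => - ((e - t) `^ a * a^-1))).
    near=> s; rewrite distrC ger0_norm// subr_ge0 ltW//; near: s; exact: lt_nbhsl.
  have h1 : is_derive t 1 (fun s => e - s) (- 1).
    have := is_derive_affine e (- 1) t.
    by rewrite (_ : (fun _ => _) = fun s => e - s)//; apply/funext => s; rewrite mulN1r.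
  have h2 := @is_derive_fun_comp _ (fun s => s `^ a) (fun s => e - s) _ _ _
     (is_derive_powR a te) h1.
  have h3 := is_derive_fun_opp (is_derive_fun_mul h2 (is_derive_cst a^-1 t (1 : R))).
  apply: (is_derive_eq h3); rewrite distrC (gtr0_norm te) /cst; field.
  by rewrite !gt_eqF.
have le : mu.-integrable `[x, e] (fun t => (`|t - e| `^ a / `|t - e|)%:E).
  have h : Num.min x (e - 1) < e by rewrite gt_min; apply/orP; right; lra.
  apply: integrableS (left _ h) => //=; apply: subset_itvr.
  by rewrite bnd_simp ge_min lexx.
have re : mu.-integrable `[e, y] (fun t => (`|t - e| `^ a / `|t - e|)%:E).
  have h : e < Num.max y (e + 1) by rewrite lt_max; apply/orP; right; lra.
  apply: integrableS (right _ h) => //=; apply: subset_itvl.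
  by rewrite bnd_simp le_max lexx.
exact: integrable_itv_cat le re.
Unshelve. all: by end_near. Qed.

End power_singularity.

(** * Solutions by the integrating factor *)

Section solution.
Context {R : realType}.
Local Notation mu := (@lebesgue_measure R).
Implicit Types (a b : R) (f g h H : R -> R).

Lemma is_derive_norm_powR a (x : R) : x != 0 ->
  is_derive x 1 (fun t => `|t| `^ a) (a * `|x| `^ a / x).
Proof.
move=> x0; have [xn|xp] := ltP x 0.
  apply: (@is_derive_near _ (fun t => (- t) `^ a)).
    near=> t; rewrite ltr0_norm//; near: t; exact: lt_nbhsl.
  have nx : 0 < - x by rewrite oppr_gt0.
  have h := @is_derive_fun_comp _ (fun s => s `^ a) (fun s => - s) _ _ _
     (is_derive_powR a nx) (is_derive_fun_opp (is_derive_id x (1 : R))).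
  by apply: (is_derive_eq h); rewrite ltr0_norm//; field.
have xp' : 0 < x by rewrite lt_def x0.
apply: (@is_derive_near _ (fun t => t `^ a)).
  near=> t; rewrite gtr0_norm//; near: t; exact: lt_nbhsr.
by rewrite gtr0_norm//; exact: is_derive_powR.
Unshelve. all: by end_near. Qed.

(** The integrating factor of the Stein equation: its logarithmic derivative is
    (a - (a + b) x) / (x (1 - x)) on each of the three intervals. *)
Definition stein_weight a b (x : R) : R := `|x| `^ a * `|1 - x| `^ b.

Lemma stein_weight_gt0 a b (x : R) : x != 0 -> x != 1 -> 0 < stein_weight a b x.
Proof.
move=> x0 x1; rewrite mulr_gt0// powR_gt0// normr_gt0//.
by rewrite subr_eq0 eq_sym.
Qed.

Lemma is_derive_stein_weight a b (x : R) : x != 0 -> x != 1 ->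
  is_derive x 1 (stein_weight a b)
    ((a - (a + b) * x) * stein_weight a b x / (x * (1 - x))).
Proof.
move=> x0 x1; have x1' : 1 - x != 0 by rewrite subr_eq0 eq_sym.
have h := is_derive_fun_mul (is_derive_norm_powR a x0)
  (@is_derive_fun_comp _ (fun t => `|t| `^ b) (fun t => 1 - t) _ _ _
    (is_derive_norm_powR b x1') (is_derive_onem x)).
apply: (is_derive_eq h); rewrite /stein_weight; field.
by rewrite x0 x1'.
Qed.

(** The derivative of the product of a solution and the integrating factor. *)
Definition stein_integrand a b H (x : R) : R :=
  H x * (stein_weight a b x / (x * (1 - x))).

Lemma continuous_stein_integrand a b H (x : R) : continuous H ->
  x != 0 -> x != 1 -> {for x, continuous (stein_integrand a b H)}.
Proof.
move=> Hc x0 x1; have x1' : 1 - x != 0 by rewrite subr_eq0 eq_sym.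
apply: cvgM; first exact: Hc.
apply: cvgM; first exact: is_derive_continuous (is_derive_stein_weight a b x0 x1).
apply: cvgV; first by rewrite mulf_neq0.
apply: cvgM; first exact: cvg_id.
by apply: cvgB; [exact: cvg_cst|exact: cvg_id].
Qed.

(** The weight over x (1 - x) is the product of a singular factor at 0 and one at
    1. At each point the one whose singularity is at distance at least 1/2 is
    bounded by 2 N^a or 2 N^b. *)
Lemma integrable_stein_integrand a b H (x y : R) : 0 < a -> 0 < b ->
  continuous H -> mu.-integrable `[x, y] (EFin \o stein_integrand a b H).
Proof.
move=> a0 b0 Hc; have [xy|yx] := leP x y; last first.
  by rewrite set_itv_ge ?bnd_simp -?ltNge//; exact: integrable_set0.
have mg : measurable_fun setT (stein_integrand a b H).
  apply: (@measurable_fun_off2 _ _ 0 1) => t t0 t1.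
  exact: continuous_stein_integrand.
have [c _ hc] := @EVT_max R (fun t => `|H t|) x y xy (continuous_subspaceT (fun t => cvg_norm (Hc t))).
pose B : R := `|H c|.
pose N : R := `|x| + `|y| + 1.
have N0 : 0 <= N by rewrite !addr_ge0.
pose s0 (t : R) : R := `|t - 0| `^ a / `|t - 0|.
pose s1 (t : R) : R := `|t - 1| `^ b / `|t - 1|.
have is0 := @integrable_power_singularity R a 0 x y a0.
have is1 := @integrable_power_singularity R b 1 x y b0.
have iD : mu.-integrable `[x, y]
    (fun t => (B * (2 * N `^ b))%:E * (s0 t)%:E + (B * (2 * N `^ a))%:E * (s1 t)%:E)%E.
  by apply: integrableD => //; exact: integrableZl.
apply: le_integrable iD => //; first by apply/measurable_EFinP; exact: measurable_funTS.
move=> t; rewrite /= in_itv/= => /andP[xt ty].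
have B0 : 0 <= B by exact: normr_ge0.
have pa : 0 <= 2 * N `^ a by rewrite mulr_ge0// powR_ge0.
have pb : 0 <= 2 * N `^ b by rewrite mulr_ge0// powR_ge0.
have s0_ge0 : 0 <= s0 t by rewrite divr_ge0// powR_ge0.
have s1_ge0 : 0 <= s1 t by rewrite divr_ge0// powR_ge0.
rewrite lee_fin [leRHS]ger0_norm; last first.
  exact: addr_ge0 (mulr_ge0 (mulr_ge0 B0 pb) s0_ge0) (mulr_ge0 (mulr_ge0 B0 pa) s1_ge0).
have -> : `|stein_integrand a b H t| = `|H t| * (s0 t * s1 t).
  rewrite /stein_integrand normrM; congr (_ * _).
  rewrite /stein_weight /s0 /s1 subr0 (distrC t) normrM normfV normrM.
  by rewrite !(ger0_norm (powR_ge0 _ _)) normrM invfM; ring.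
have tN : `|t| <= `|x| + `|y|.
  have := ler_norm y; have := ler_norm (- x); rewrite normrN.
  have := normr_ge0 x; have := normr_ge0 y; rewrite ler_norml; lra.
have t1N : `|t - 1| <= N by rewrite (le_trans (ler_normB _ _))// normr1 lerD2r.
have t0N : `|t - 0| <= N by rewrite subr0 (le_trans tN)// lerDl.
have HB : `|H t| <= B by apply: hc; rewrite in_itv/= xt.
rewrite -!(mulrA B) -mulrDr ler_pM//; first exact: mulr_ge0.
have half (e z : R) : 0 < e -> 2^-1 <= `|z| -> `|z| <= N -> `|z| `^ e / `|z| <= 2 * N `^ e.
  move=> e0 z2 zN; rewrite mulrC ler_pM ?invr_ge0 ?powR_ge0//.
    by rewrite -[leRHS]invrK lef_pV2 ?posrE ?invr_gt0// (lt_le_trans _ z2)// invr_gt0.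
  by rewrite ge0_ler_powR ?nnegrE// ltW.
have [t2|t2] := leP 2^-1 `|t - 0|.
  rewrite -[leLHS]add0r lerD//; first exact: mulr_ge0.
  by rewrite ler_wpM2r//; exact: half.
rewrite -[leLHS]addr0 lerD//; last exact: mulr_ge0.
rewrite mulrC ler_wpM2r//; apply: half => //.
have := ler_normB (t - 0) (t - 1); rewrite (_ : t - 0 - (t - 1) = 1) ?normr1; last ring.
by move: t2; lra.
Qed.

(** Needed where an integrand involving powers with exponents a - 1 and b - 1
    takes conventional values at an endpoint. *)
Lemma eq_Rintegral_oo f g (x y : R) :
  {in `]x, y[, f =1 g} -> measurable_fun setT g ->
  \int[mu]_(t in `[x, y]) f t = \int[mu]_(t in `[x, y]) g t.
Proof.
move=> fg mg; rewrite /Rintegral (@eq_integral_itv_bounded _ x y g f)//.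
- apply: (eq_measurable_fun g); last exact: measurable_funTS.
  by move=> t; rewrite inE => /fg ->.
- exact: measurable_funTS.
Qed.

(** Dividing a primitive that vanishes at 0 by the integrating factor gives a
    solution with the boundary condition at 0. The boundary condition at 1 holds
    because the primitive vanishes there too. *)
Lemma stein_equation_of_primitive a b f H J : continuous J ->
  (forall x : R, x != 0 -> x != 1 -> is_derive x 1 J (stein_integrand a b H x)) ->
  J 0 = J 1 ->
  (forall x : R, x != 0 -> x != 1 -> f x = (J x - J 0) / stein_weight a b x) ->
  stein_equation a b f (fun x => (H x - (a - (a + b) * x) * f x) / (x * (1 - x))) H.
Proof.
move=> Jc dJ J01 fE; split.
- move=> x x0 x1; have x1' : 1 - x != 0 by rewrite subr_eq0 eq_sym.
  have w0 : stein_weight a b x != 0 by rewrite gt_eqF// stein_weight_gt0.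
  apply: (@is_derive_near _ (fun y => (J y - J 0) / stein_weight a b y)).
    near=> y; rewrite fE//; near: y; exact: near_neq.
  have h := is_derive_fun_mul
    (is_derive_fun_add (dJ _ x0 x1) (is_derive_cst (- J 0) x (1 : R)))
    (is_derive_fun_inv w0 (is_derive_stein_weight a b x0 x1)).
  apply: (is_derive_eq h); rewrite fE// /stein_integrand /cst; field.
  by rewrite x0 x1' w0.
- move=> x x0 x1; have x1' : 1 - x != 0 by rewrite subr_eq0 eq_sym.
  by field; rewrite x0 x1'.
- have hl : (J t - J 0) / `|1 - t| `^ b @[t --> (0 : R)^'] --> (J 0 - J 0) / `|1 - 0| `^ b.
    apply: cvgM; first by apply: cvgB; [apply: cvg_trans (Jc 0); apply: cvg_app; exact: nbhs_dnbhs|exact: cvg_cst].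
    apply: cvgV; first by rewrite subr0 normr1 powR1 oner_eq0.
    have h1 : 1 - (0 : R) != 0 by rewrite subr0 oner_eq0.
    have := is_derive_continuous (@is_derive_fun_comp _ (fun t => `|t| `^ b) (fun t => 1 - t) _ _ _
      (is_derive_norm_powR b h1) (is_derive_onem 0)).
    by apply: cvg_trans; apply: cvg_app; exact: nbhs_dnbhs.
  move: hl; rewrite subrr mul0r; apply: cvg_trans; apply: near_eq_cvg; near=> t.
  have t0 : t != 0 by near: t; exact: nbhs_dnbhs_neq.
  have t1 : t != 1 by near: t; apply: nbhs_dnbhs; apply: near_neq; rewrite eq_sym oner_eq0.
  have tp : `|t| `^ a != 0 by rewrite gt_eqF// powR_gt0// normr_gt0.
  have t1p : `|1 - t| `^ b != 0 by rewrite gt_eqF// powR_gt0// normr_gt0 subr_eq0 eq_sym.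
  by rewrite fE// /stein_weight; field; rewrite tp t1p.
- have hl : (J t - J 1) / `|t| `^ a @[t --> (1 : R)^'] --> (J 1 - J 1) / `|1| `^ a.
    apply: cvgM; first by apply: cvgB; [apply: cvg_trans (Jc 1); apply: cvg_app; exact: nbhs_dnbhs|exact: cvg_cst].
    apply: cvgV; first by rewrite normr1 powR1 oner_eq0.
    have := is_derive_continuous (is_derive_norm_powR a (oner_neq0 R)).
    by apply: cvg_trans; apply: cvg_app; exact: nbhs_dnbhs.
  move: hl; rewrite subrr mul0r; apply: cvg_trans; apply: near_eq_cvg; near=> t.
  have t1 : t != 1 by near: t; exact: nbhs_dnbhs_neq.
  have t0 : t != 0 by near: t; apply: nbhs_dnbhs; apply: near_neq; rewrite oner_eq0.
  have tp : `|t| `^ a != 0 by rewrite gt_eqF// powR_gt0// normr_gt0.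
  have t1p : `|1 - t| `^ b != 0 by rewrite gt_eqF// powR_gt0// normr_gt0 subr_eq0 eq_sym.
  by rewrite fE// -J01 /stein_weight; field; rewrite tp t1p.
Unshelve. all: by end_near. Qed.

End solution.

(** * The explicit solution for the beta law *)

Section beta_solution.
Context {R : realType}.
Local Notation mu := (@lebesgue_measure R).
Variables (a b : R).
Hypotheses (a0 : 0 < a) (b0 : 0 < b).
Implicit Types (h : R -> R).

Lemma powR_pred (e x : R) : 0 < x -> x `^ (e - 1) = x `^ e / x.
Proof.
move=> x0; have xn : x != 0 by rewrite gt_eqF.
by rewrite powRB ?xn ?implybT// powRr1// ltW.
Qed.

Let Hint h : continuous h -> measurable_fun setT (stein_integrand a b h).
Proof.
move=> hc; apply: (@measurable_fun_off2 _ _ 0 1) => t t0 t1.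
exact: continuous_stein_integrand.
Qed.

Lemma beta_weightE (t : R) : t \in `]0, 1[ ->
  beta_weight a b t = stein_weight a b t / (t * (1 - t)).
Proof.
rewrite in_itv/= => /andP[t0 t1]; have t1' : 0 < 1 - t by rewrite subr_gt0.
rewrite /beta_weight /stein_weight !powR_pred// !gtr0_norm//; field.
by rewrite !gt_eqF.
Qed.

(** On (0, 1) the weight over x (1 - x) is the unnormalised beta density. *)
Lemma BetaE : Beta a b = \int[mu]_(t in `[0, 1]) stein_integrand a b (cst 1) t.
Proof.
have m1 := Hint (@cst_continuous R R 1).
rewrite /Beta {2}/Rintegral (@integral_itv_bndoo _ _ _ _ true false); last first.
  by apply/measurable_EFinP; exact: measurable_funTS.
apply: eq_Rintegral => t; rewrite inE/= => t01.
by rewrite /stein_integrand mul1r beta_weightE.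
Qed.

Lemma Beta_gt0 : 0 < Beta a b.
Proof.
have c1 : continuous (cst 1 : R -> R) by exact: cst_continuous.
have [J [Jc dJ JB]] := antiderivative_exists
  (fun x y => integrable_stein_integrand x y a0 b0 c1).
rewrite BetaE -JB//.
have n0 (x : R) : x \in `]0, 1[ -> x != 0 /\ x != 1.
  by rewrite in_itv/= => /andP[x0 x1]; rewrite gt_eqF// lt_eqF.
have [||xi xi01 ->] := @MVT _ J (stein_integrand a b (cst 1)) _ _ (@ltr01 R).
- by move=> x /n0[x0 x1]; apply: dJ; exact: continuous_stein_integrand.
- exact: continuous_subspaceT.
have [x0 x1] := n0 _ xi01; move: xi01; rewrite in_itv/= => /andP[xi0 xi1].
rewrite subr0 mulr1 /stein_integrand mul1r divr_gt0 ?stein_weight_gt0//.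
by rewrite mulr_gt0// subr_gt0.
Qed.

Lemma Rintegral_beta_law h : continuous h ->
  \int[beta_law a b]_t h t =
  (Beta a b)^-1 * \int[mu]_(t in `[0, 1]) stein_integrand a b h t.
Proof.
move=> hc; have mh := continuous_measurable_fun hc.
rewrite -RintegralZl//; last exact: integrable_stein_integrand.
rewrite /Rintegral (@integral_density _ _ _ mu _ (beta_density a b))//; last 3 first.
- exact: beta_density_ge0.
- exact: measurable_beta_density.
- exact/measurable_EFinP.
congr fine; rewrite (@integral_itv_bndoo _ _ _ _ true false); last first.
  by apply/measurable_EFinP; apply: measurable_funM => //; exact: measurable_funTS (Hint hc).
rewrite [RHS]integral_mkcond; apply: eq_integral => t _.
rewrite patchE /beta_density indicE; case: ifPn => /=.
  rewrite inE/= => t01; rewrite mulr1 beta_weightE// -EFinM /stein_integrand.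
  by congr EFin; ring.
by rewrite mulr0 mule0.
Qed.

Lemma continuous_centered h : continuous h -> continuous (centered a b h).
Proof. by move=> hc x; apply: cvgB; [exact: hc|exact: cvg_cst]. Qed.

(** The beta law has total mass 1, so a centered function has mean 0. *)
Lemma centered_mean0 h : continuous h ->
  \int[mu]_(t in `[0, 1]) stein_integrand a b (centered a b h) t = 0.
Proof.
move=> hc; pose c := \int[beta_law a b]_t h t.
have c1 : continuous (cst 1 : R -> R) by exact: cst_continuous.
transitivity (\int[mu]_(t in `[0, 1]) (stein_integrand a b h t -
    c * stein_integrand a b (cst 1) t)).
  by apply: eq_Rintegral => t _; rewrite /stein_integrand /centered -/c /cst; ring.
have ih := integrable_stein_integrand 0 1 a0 b0 hc.
have i1 := integrable_stein_integrand 0 1 a0 b0 c1.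
rewrite RintegralB//; last first.
  have i2 : mu.-integrable `[0, 1]
      (fun t => c%:E * (stein_integrand a b (cst 1) t)%:E)%E by exact: integrableZl.
  exact: i2.
rewrite RintegralZl// -BetaE /c Rintegral_beta_law//.
by rewrite mulrAC mulVf ?mul1r ?subrr// gt_eqF// Beta_gt0.
Qed.

(** Since the primitive J of the integrand takes the same value at 0 and 1, the
    three integral formulas, with base points 0, 0 and 1, are one and the same
    formula (J x - J 0) / stein_weight x. *)
Lemma stein_sol_equation h : continuous h ->
  stein_equation a b (stein_sol a b h)
    (fun x => (centered a b h x - (a - (a + b) * x) * stein_sol a b h x)
              / (x * (1 - x)))
    (centered a b h).
Proof.
move=> hc; have Hc := continuous_centered hc.
have iH := integrable_stein_integrand _ _ a0 b0 Hc.
have [J [Jc dJ JB]] := antiderivative_exists iH.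
have J01 : J 0 = J 1.
  by apply/esym/eqP; rewrite -subr_eq0 JB// centered_mean0.
apply: (stein_equation_of_primitive Jc) => //.
  by move=> x x0 x1; apply: dJ; exact: continuous_stein_integrand.
have mH := Hint Hc.
move=> x x0 x1; rewrite /stein_sol (negbTE x0) (negbTE x1).
have [xn|xp] := ltP x 0.
  have -> : \int[mu]_(t in `[x, 0]) (centered a b h t * `|t| `^ (a - 1) * (1 - t) `^ (b - 1)) =
      \int[mu]_(t in `[x, 0]) (- 1 * stein_integrand a b (centered a b h) t).
    apply: eq_Rintegral_oo; last exact: measurable_funM.
    move=> t; rewrite in_itv/= => /andP[xt t0].
    have t1 : 0 < 1 - t by lra.
    rewrite !powR_pred// ?normr_gt0 ?lt_eqF//.
    rewrite /stein_integrand /stein_weight (ltr0_norm t0) (gtr0_norm t1); field.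
    by rewrite gt_eqF//= lt_eqF.
  rewrite RintegralZl// -JB ?ltW// /stein_weight (gtr0_norm (_ : 0 < 1 - x)); last lra.
  ring.
have xgt0 : 0 < x by rewrite lt_def x0.
have [xlt1|xge1] := ltP x 1.
  have -> : \int[mu]_(t in `[0, x]) (centered a b h t * beta_density a b t) =
      \int[mu]_(t in `[0, x]) ((Beta a b)^-1 * stein_integrand a b (centered a b h) t).
    apply: eq_Rintegral_oo; last exact: measurable_funM.
    move=> t; rewrite in_itv/= => /andP[t0 tx].
    have t01 : t \in `]0, 1[ by rewrite in_itv/= t0 (lt_trans tx).
    rewrite /beta_density beta_weightE// indicE mem_set//= /stein_integrand mulr1; ring.
  rewrite RintegralZl// -JB//.
  have x01 : x \in `]0, 1[ by rewrite in_itv/= xgt0.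
  rewrite /beta_density beta_weightE// indicE mem_set//=.
  have B0 := Beta_gt0; have w0 := stein_weight_gt0 a b x0 x1; field.
  by rewrite !gt_eqF// subr_gt0.
have xgt1 : 1 < x by rewrite lt_def x1.
have -> : \int[mu]_(t in `[1, x]) (centered a b h t * t `^ (a - 1) * (t - 1) `^ (b - 1)) =
    \int[mu]_(t in `[1, x]) (- 1 * stein_integrand a b (centered a b h) t).
  apply: eq_Rintegral_oo; last exact: measurable_funM.
  move=> t; rewrite in_itv/= => /andP[t1 tx].
  have t0 : 0 < t by lra.
  have t1' : 0 < t - 1 by lra.
  rewrite !powR_pred//.
  rewrite /stein_integrand /stein_weight (distrC 1) (gtr0_norm t0) (gtr0_norm t1'); field.
  by rewrite subr_eq0 lt_eqF//= !gt_eqF.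
rewrite RintegralZl// -JB ?ltW// /stein_weight (distrC 1) -J01.
rewrite (gtr0_norm xgt0) (gtr0_norm (_ : 0 < x - 1)); last lra.
ring.
Qed.

End beta_solution.

(** * Regularity of the explicit solution *)

Section lipschitz_constant.
Context {R : realType}.
Implicit Types (h : R -> R).

Lemma klipschitzE (k : R) h :
  k.-lipschitz h <-> forall x y : R, `|h x - h y| <= k * `|x - y|.
Proof.
split=> [hk x y|hk]; first by have := hk (x, y) (conj I I).
by move=> [x y] _; exact: hk.
Qed.

Lemma lip_constP h : lipschitz h ->
  forall x y, `|h x - h y| <= lip_const h * `|x - y|.
Proof.
move=> [M [_ hM]] x y; have [->|xy] := eqVneq x y.
  by rewrite !subrr normr0 mulr0.
have xy0 : 0 < `|x - y| by rewrite normr_gt0 subr_eq0.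
rewrite -ler_pdivrMr//; apply: lb_le_inf.
  by exists (M + 1); apply: hM; rewrite ltrDl.
by move=> k /klipschitzE hk; rewrite ler_pdivrMr.
Qed.

Lemma lip_const_ge0 h : 0 <= lip_const h.
Proof.
rewrite /lip_const; set A := [set k : R | _].
have [->|/set0P A0] := eqVneq A set0; first by rewrite inf0.
apply: lb_le_inf => // k /klipschitzE /(_ 1 0); rewrite subr0 normr1 mulr1.
exact: le_trans.
Qed.

Lemma lipschitz_continuous h (k : R) :
  (forall x y, `|h x - h y| <= k * `|x - y|) -> continuous h.
Proof. by move=> hk x; apply/continuous_withinNx; exact: lipschitz_cvg_dnbhs hk. Qed.

Lemma bounded_fun_exists h : bounded_fun h -> exists M : R, forall x, `|h x| <= M.
Proof.
by move=> [M [_ hM]]; exists (M + 1) => x; apply: hM => //; rewrite ltrDl.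
Qed.

Lemma derive1n2E h : h^`(2)%classic = (h^`()%classic)^`()%classic.
Proof. by []. Qed.

(** The second derivative may be discontinuous, and it is only its essential
    supremum K that enters the bounds; the Lipschitz estimate of h' in terms of
    K is [lipschitz_of_ae_bound]. *)
Lemma twice_diff_boundedP h : twice_diff_bounded h ->
  exists K : R, [/\ 0 <= K, ess_norm h^`(2)%classic = K%:E, lipschitz h,
    forall x : R, is_derive x 1 h (h^`()%classic x) &
    forall x y, `|h^`()%classic x - h^`()%classic y| <= K * `|x - y| ].
Proof.
move=> [d1 d2 /bounded_fun_exists[M1 hM1] /bounded_fun_exists[M2 hM2]].
have hd (x : R) : is_derive x 1 h (h^`()%classic x).
  by rewrite derive1E; exact: derivableP.
have hdd (x : R) : is_derive x 1 h^`()%classic (h^`(2)%classic x).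
  by rewrite derive1n2E [X in is_derive _ _ _ X]derive1E; exact: derivableP.
have he : (ess_norm h^`(2)%classic <= M2%:E)%E by apply: ess_norm_off01.
have [K KE] : exists K : R, ess_norm h^`(2)%classic = K%:E.
  exists (fine (ess_norm h^`(2)%classic)); rewrite fineK// ge0_fin_numE ?ess_norm_ge0//.
  exact: le_lt_trans he (ltry _).
exists K; split => //.
- by rewrite -lee_fin -KE ess_norm_ge0.
- exists M1; split; first exact: num_real.
  move=> k /ltW M1k; apply/klipschitzE.
  have hc : continuous h by move=> x; exact: is_derive_continuous (hd x).
  exact: (lipschitz_off01 hc (fun x _ _ => hd x) (fun x _ _ => le_trans (hM1 x) M1k)).
- apply: (lipschitz_of_ae_bound hdd hM2); apply/ess_normP; rewrite KE//.
Qed.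

End lipschitz_constant.

Section stein_solution_regularity.
Context {R : realType}.
Variables (a b : R).
Hypotheses (a0 : 0 < a) (b0 : 0 < b).

(** For a Lipschitz right-hand side the quantity M of [stein_derive_bound] can be
    taken equal to L / (a + b). *)
Lemma stein_derive_lipschitz (c d : R) f df H (L x : R) : 0 < c -> 0 < d ->
  stein_equation c d f df H -> 0 <= L ->
  (forall s t, `|H s - H t| <= L * `|s - t|) -> x != 0 -> x != 1 ->
  `|df x| <= 2 * stein_factor c d * L.
Proof.
move=> c0 d0 hf L0 hH x0 x1.
have := stein_derive_bound c0 d0 hf L0 hH (stein_rhs0 c0 d0 hf hH)
  (stein_rhs1 c0 d0 hf hH) (fun t t0 t1 => stein_sup c0 d0 hf hH t0 t1) x0 x1.
rewrite mulrCA divff ?mulr1; last by rewrite gt_eqF// addr_gt0.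
by rewrite (_ : _ * (L + L) = 2 * stein_factor c d * L)//; ring.
Qed.

Variables (h : R -> R) (L : R).
Hypothesis (hL : forall x y, `|h x - h y| <= L * `|x - y|).

Local Notation f := (stein_sol a b h).
Local Notation H := (centered a b h).

Let hc : continuous h := lipschitz_continuous hL.
Let L0 : 0 <= L.
Proof. by have := hL 1 0; rewrite subr0 normr1 mulr1; exact: le_trans. Qed.

Let HL x y : `|H x - H y| <= L * `|x - y|.
Proof.
rewrite /centered (_ : _ - _ - _ = h x - h y)//; ring.
Qed.

Let df x := (H x - (a - (a + b) * x) * f x) / (x * (1 - x)).
Let hf : stein_equation a b f df H := stein_sol_equation a0 b0 hc.

Lemma stein_sol_continuous : continuous f.
Proof.
move=> x; have [->|x0] := eqVneq x 0.
  apply/continuous_withinNx; rewrite [f 0]/stein_sol eqxx.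
  exact: (stein_cvg0 a0 b0 hf (lipschitz_cvg_dnbhs HL)).
have [->|x1] := eqVneq x 1.
  apply/continuous_withinNx; rewrite [f 1]/stein_sol oner_eq0 eqxx mulNr.
  exact: (stein_cvg1 a0 b0 hf (lipschitz_cvg_dnbhs HL)).
exact: is_derive_continuous (stein_derive hf x0 x1).
Qed.

Lemma stein_sol_le x : `|f x| <= L / (a + b).
Proof.
have h0 : `|H 0 / a| <= L / (a + b).
  rewrite normrM normfV (gtr0_norm a0) ler_pdivrMr// mulrC.
  exact: stein_rhs0 hf HL.
have h1 : `|- H 1 / b| <= L / (a + b).
  rewrite normrM normfV normrN (gtr0_norm b0) ler_pdivrMr// mulrC.
  exact: stein_rhs1 hf HL.
have [->|x0] := eqVneq x 0; first by rewrite /stein_sol eqxx.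
have [->|x1] := eqVneq x 1; first by rewrite /stein_sol oner_eq0 eqxx.
exact: (stein_sup a0 b0 hf HL x0 x1).
Qed.

Lemma stein_sol_derive1_le x : x != 0 -> x != 1 ->
  `|f^`()%classic x| <= 2 * stein_factor a b * L.
Proof.
move=> x0 x1; rewrite (is_derive_derive1 (stein_derive hf x0 x1)).
exact: (stein_derive_lipschitz a0 b0 hf L0 HL x0 x1).
Qed.

Let fL := lipschitz_off01 stein_sol_continuous
  (fun x x0 x1 => stein_derive hf x0 x1)
  (fun x x0 x1 => stein_derive_lipschitz a0 b0 hf L0 HL x0 x1).

Variables (dh : R -> R) (K : R).
Hypothesis (hdh : forall x : R, is_derive x 1 h (dh x)).
Hypothesis (hK : forall x y, `|dh x - dh y| <= K * `|x - y|).

(* the right-hand side of the Stein equation of the derivative, and a Lipschitz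
   constant of it *)
Let H2 x := dh x + (a + b) * f x.
Let L2 := K + (a + b) * (2 * stein_factor a b * L).

Let K0 : 0 <= K.
Proof. by have := hK 1 0; rewrite subr0 normr1 mulr1; exact: le_trans. Qed.

Let H2L x y : `|H2 x - H2 y| <= L2 * `|x - y|.
Proof.
rewrite /H2 /L2 (_ : _ - _ = (dh x - dh y) + (a + b) * (f x - f y)); last ring.
rewrite (le_trans (ler_normD _ _))// [leRHS]mulrDl lerD// normrM.
rewrite (gtr0_norm (addr_gt0 a0 b0)) -mulrA.
by apply: ler_wpM2l; [rewrite ltW// addr_gt0|exact: fL].
Qed.

Let L20 : 0 <= L2.
Proof. by have := H2L 1 0; rewrite subr0 normr1 mulr1; exact: le_trans. Qed.

Let hdf : stein_equation (a + 1) (b + 1) df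
    (fun x => (H2 x - (a + 1 - (a + 1 + (b + 1)) * x) * df x) / (x * (1 - x))) H2.
Proof.
have hdH (x : R) : is_derive x 1 H (dh x).
  by apply: (@is_derive_eq _ _ _ _ _ _ _ (dh x + 0)); rewrite addr0.
exact: (stein_shift a0 b0 hf (fun x _ _ => hdH x)
  (lipschitz_cvg_dnbhs HL) (lipschitz_cvg_dnbhs HL)).
Qed.

Let a1 : 0 < a + 1. Proof. exact: addr_gt0. Qed.
Let b1 : 0 < b + 1. Proof. exact: addr_gt0. Qed.

Let df0 := stein_cvg0 a1 b1 hdf (lipschitz_cvg_dnbhs H2L).
Let df1 := stein_cvg1 a1 b1 hdf (lipschitz_cvg_dnbhs H2L).

Let fd0 : is_derive (0 : R) 1 f (H2 0 / (a + 1)).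
Proof.
apply: (is_derive_of_limit (df := df)); [exact: stein_sol_continuous| |exact: df0].
near=> t; apply: (stein_derive hf); near: t; first exact: nbhs_dnbhs_neq.
by apply: nbhs_dnbhs; apply: near_neq; rewrite eq_sym oner_eq0.
Unshelve. all: by end_near. Qed.

Let fd1 : is_derive (1 : R) 1 f (- (H2 1 / (b + 1))).
Proof.
apply: (is_derive_of_limit (df := df)); [exact: stein_sol_continuous| |exact: df1].
near=> t; apply: (stein_derive hf); near: t; last exact: nbhs_dnbhs_neq.
by apply: nbhs_dnbhs; apply: near_neq; rewrite oner_eq0.
Unshelve. all: by end_near. Qed.

Lemma stein_sol_is_derive (x : R) : is_derive x 1 f (f^`()%classic x).
Proof.
have [->|x0] := eqVneq x 0; first by rewrite (is_derive_derive1 fd0).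
have [->|x1] := eqVneq x 1; first by rewrite (is_derive_derive1 fd1).
have hx := stein_derive hf x0 x1.
by rewrite (is_derive_derive1 hx).
Qed.

Let fdE x : x != 0 -> x != 1 -> f^`()%classic x = df x.
Proof. by move=> x0 x1; exact: is_derive_derive1 (stein_derive hf x0 x1). Qed.

Lemma stein_sol_derive1_continuous : continuous (f^`()%classic).
Proof.
move=> x; have [->|x0] := eqVneq x 0.
  apply/continuous_withinNx; rewrite (is_derive_derive1 fd0).
  apply: cvg_trans df0; apply: near_eq_cvg; near=> t; apply/esym/fdE; near: t.
    exact: nbhs_dnbhs_neq.
  by apply: nbhs_dnbhs; apply: near_neq; rewrite eq_sym oner_eq0.
have [->|x1] := eqVneq x 1.
  apply/continuous_withinNx; rewrite (is_derive_derive1 fd1).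
  apply: cvg_trans df1; apply: near_eq_cvg; near=> t; apply/esym/fdE; near: t.
    by apply: nbhs_dnbhs; apply: near_neq; rewrite oner_eq0.
  exact: nbhs_dnbhs_neq.
rewrite /continuous_at fdE//.
have := is_derive_continuous (stein_derive hdf x0 x1).
apply: cvg_trans; apply: near_eq_cvg; near=> t; apply/esym/fdE; near: t;
  exact: near_neq.
Unshelve. all: by end_near. Qed.

Let fdd (x : R) : x != 0 -> x != 1 -> is_derive x 1 (f^`()%classic)
  ((H2 x - (a + 1 - (a + 1 + (b + 1)) * x) * df x) / (x * (1 - x))).
Proof.
move=> x0 x1; apply: is_derive_near (stein_derive hdf x0 x1).
by near=> t; apply/esym/fdE; near: t; exact: near_neq.
Unshelve. all: by end_near. Qed.

Lemma stein_sol_is_derive2 (x : R) : x != 0 -> x != 1 ->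
  is_derive x 1 (f^`()%classic) (f^`(2)%classic x).
Proof.
move=> x0 x1; have hx := fdd x0 x1.
by rewrite derive1n2E (is_derive_derive1 hx).
Qed.

Lemma stein_sol_derive2_le x : x != 0 -> x != 1 ->
  `|f^`(2)%classic x| <= 2 * stein_factor (a + 1) (b + 1) * L2.
Proof.
move=> x0 x1; rewrite derive1n2E (is_derive_derive1 (fdd x0 x1)).
exact: (stein_derive_lipschitz a1 b1 hdf L20 H2L x0 x1).
Qed.

Lemma stein_sol_derive2_continuous x : x != 0 -> x != 1 ->
  {for x, continuous f^`(2)%classic}.
Proof.
move=> x0 x1; have x1' : 1 - x != 0 by rewrite subr_eq0 eq_sym.
have hE t : t != 0 -> t != 1 -> f^`(2)%classic t =
    (H2 t - (a + 1 - (a + 1 + (b + 1)) * t) * df t) / (t * (1 - t)).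
  by move=> t0 t1; rewrite derive1n2E (is_derive_derive1 (fdd t0 t1)).
rewrite /prop_for /continuous_at hE//.
suff : (H2 t - (a + 1 - (a + 1 + (b + 1)) * t) * df t) / (t * (1 - t)) @[t --> x] -->
    (H2 x - (a + 1 - (a + 1 + (b + 1)) * x) * df x) / (x * (1 - x)).
  apply: cvg_trans; apply: near_eq_cvg; near=> t; apply/esym/hE; near: t;
  exact: near_neq.
apply: cvgM.
  apply: cvgB; first exact: lipschitz_continuous H2L x.
  apply: cvgM; last exact: is_derive_continuous (stein_derive hdf x0 x1).
  by apply: cvgB; [exact: cvg_cst|apply: cvgM; [exact: cvg_cst|exact: cvg_id]].
apply: cvgV; first by rewrite mulf_neq0.
apply: cvgM; first exact: cvg_id.
by apply: cvgB; [exact: cvg_cst|exact: cvg_id].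
Unshelve. all: by end_near. Qed.

Lemma stein_sol_ode x :
  x * (1 - x) * f^`()%classic x + (a - (a + b) * x) * f x = centered a b h x.
Proof.
have [->|x0] := eqVneq x 0.
  by rewrite !mul0r mulr0 subr0 add0r /stein_sol eqxx mulrC divfK// gt_eqF.
have [->|x1] := eqVneq x 1.
  rewrite subrr mulr0 mul0r add0r /stein_sol oner_eq0 eqxx; field.
  by rewrite gt_eqF.
by rewrite fdE//; exact: (stein_ode hf x0 x1).
Qed.

End stein_solution_regularity.

(** The first bound is [stein_derive_bound] for f; the second one is the same
    bound for f', whose right-hand side h' + (a + b) f has Lipschitz constant
    K + (a + b) F L. *)
Lemma stein_bounds_exist (R : realType) (a b : R) : 0 < a -> 0 < b ->
  exists C1 C2 : R, stein_bounds a b C1 C2.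
Proof.
move=> a0 b0.
pose F := 2 * stein_factor a b; pose F2 := 2 * stein_factor (a + 1) (b + 1).
have pos (c d : R) : 0 < c -> 0 < d -> 0 <= 2 * stein_factor c d.
  move=> c0 d0; rewrite mulr_ge0// /stein_factor !addr_ge0 ?mulr_ge0 ?invr_ge0 ?mulr_ge0 ?addr_ge0 ?sqr_ge0 ?(ltW c0) ?(ltW d0)//.
have F0 : 0 <= F by exact: pos.
have F20 : 0 <= F2 by apply: pos; exact: addr_gt0.
exists F, (F2 * (1 + (a + b) * F)); split.
  move=> h /lip_constP hL; rewrite -EFinM; apply: ess_norm_off01 => x x0 x1.
  exact: (stein_sol_derive1_le a0 b0 hL x0 x1).
move=> h /twice_diff_boundedP[K [K0 KE /lip_constP hL hd hK]].
rewrite [in leRHS]KE -EFinD -EFinM; apply: ess_norm_off01 => x x0 x1.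
apply: (le_trans (stein_sol_derive2_le a0 b0 hL hd hK x0 x1)).
rewrite -[leLHS]/(F2 * (K + (a + b) * (F * lip_const h))) -[leRHS]mulrA.
apply: ler_wpM2l => //.
have L0 := lip_const_ge0 h.
have abF : 0 <= (a + b) * F by rewrite mulr_ge0// addr_ge0// ltW.
by nra.
Qed.

(** * Conditional expectations *)

Section conditional_expectation.
Context d (T : measurableType d) (R : realType) (P : probability T R).
Variable X : {RV P >-> R}.
Local Open Scope ereal_scope.
Import HBNNSimple.

Lemma integrable_bounded_mul (g : R -> R) (Z : T -> R) (M : R) :
  measurable_fun setT g -> (forall x, (`|g x| <= M)%R) ->
  P.-integrable setT (EFin \o Z) ->
  P.-integrable setT (fun w => (g (X w) * Z w)%:E).
Proof.
move=> mg hM iZ.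
have h : P.-integrable setT ((EFin \o (g \o X)) \* (EFin \o Z)).
  apply: integrableMr => //; first exact: measurableT_comp.
  exists M; split; first exact: num_real.
  by move=> N MN w _ /=; rewrite (le_trans (hM _))// ltW.
exact: h.
Qed.

Variable D : T -> R.
Hypothesis iD : P.-integrable setT (EFin \o D).
Hypothesis D0 : forall B : set R, measurable B -> \int[P]_(w in X @^-1` B) (D w)%:E = 0.

Let nnsfun_orthogonal (s : {nnsfun R >-> R}) : \int[P]_w (s (X w) * D w)%:E = 0.
Proof.
pose term (y : R) w := (y * (\1_(s @^-1` [set y]) (X w) * D w))%:E.
have iterm y : P.-integrable setT (term y).
  have h1 : P.-integrable setT (fun w => (\1_(s @^-1` [set y]) (X w) * D w)%:E).
    apply: (@integrable_bounded_mul _ _ 1) => // x.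
    by rewrite indicE; case: (_ \in _); rewrite ?normr1 ?normr0.
  have h2 := integrableZl measurableT y h1; exact: h2.
transitivity (\int[P]_w \sum_(y <- finmap.enum_fset (fset_set (range s))) term y w).
  apply: eq_integral => w _; rewrite fimfunE fsbig_finite//= mulr_suml sumEFin.
  by congr EFin; apply: eq_bigr => y _; rewrite mulrA.
rewrite integral_sum//; apply: big1_seq => y _.
have mA : measurable (s @^-1` [set y]) by [].
rewrite /term; under eq_integral do rewrite EFinM.
rewrite integralZl//; last first.
  apply: (@integrable_bounded_mul (\1_(s @^-1` [set y])) _ 1) => // x.
  by rewrite indicE; case: (_ \in _); rewrite ?normr1 ?normr0.
rewrite [X in _ * X](_ : _ = 0) ?mule0// -(D0 mA) [RHS]integral_mkcond.
apply: eq_integral => w _; rewrite patchE indicE /=.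
have -> : (w \in X @^-1` (s @^-1` [set y])) = (X w \in s @^-1` [set y]).
  by apply/idP/idP => /set_mem h; apply/mem_set.
by case: ifP => _; rewrite ?mul1r ?mul0r.
Qed.

(** D has conditional expectation 0 given X, hence is orthogonal to indicators of
    X-measurable events, to simple functions of X and, by dominated convergence,
    to bounded functions of X. *)
Lemma bounded_fun_orthogonal (g : R -> R) (M : R) :
  measurable_fun setT g -> (forall x, (`|g x| <= M)%R) ->
  \int[P]_w (g (X w) * D w)%:E = 0.
Proof.
move=> mg hM; have M0 : (0 <= M)%R by exact: le_trans (hM 0%R).
(* g is shifted by M because simple approximations require nonnegative functions *)
pose gM x := (g x + M)%:E : \bar R.
have mgM : measurable_fun setT gM.
  by apply/measurable_EFinP; apply: measurable_funD.
have gM0 x : [set: R] x -> 0 <= gM x.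
  by move=> _; rewrite lee_fin; have := hM x; rewrite ler_norml; lra.
pose s := nnsfun_approx measurableT mgM.
have ss x : (s n x @[n --> \oo] --> (g x + M)%R)%R.
  have := @cvg_nnsfun_approx _ _ _ _ measurableT _ mgM gM0 x I.
  by move=> /fine_cvgP[].
have sle n x : (s n x <= g x + M)%R.
  rewrite -(cvg_lim _ (ss x))//; apply: nondecreasing_cvgn_le.
    by move=> m k mk; exact/lefP/nd_nnsfun_approx.
  by apply/cvg_ex; exists (g x + M)%R; exact: ss.
have iM : P.-integrable setT (fun w => (2 * M)%:E * `|D w|%:E).
  by apply: integrableZl => //; exact: integrable_norm.
have mD : measurable_fun setT D by apply/measurable_EFinP; exact: measurable_int iD.
have mgX : measurable_fun setT (g \o X) by exact: measurableT_comp.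
have hlim : \int[P]_w (s n (X w) * D w)%:E @[n --> \oo] -->
    \int[P]_w ((g (X w) + M) * D w)%:E.
  have [|||||_ _] := @dominated_convergence _ _ _ P setT measurableT
    (fun n w => (s n (X w) * D w)%:E) (fun w => ((g (X w) + M) * D w)%:E)
    (fun w => (2 * M)%:E * `|D w|%:E).
  - move=> n; apply/measurable_EFinP; apply: measurable_funM => //.
    exact: measurableT_comp.
  - apply/measurable_EFinP; apply: measurable_funM => //.
    exact: measurable_funD.
  - apply: aeW => w _; apply: cvg_EFin; first exact: nearW.
    by apply: cvgM; [exact: ss|exact: cvg_cst].
  - exact: iM.
  - apply: aeW => w n _; rewrite -EFinM lee_fin normrM ler_wpM2r//.
    rewrite ger0_norm; last by [].
    rewrite (le_trans (sle _ _))//; have := hM (X w); rewrite ler_norml; lra.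
  - by [].
move: hlim; under eq_cvg do rewrite nnsfun_orthogonal.
move=> /(cvg_unique _ (cvg_cst 0)) h.
have iDT : \int[P]_w (D w)%:E = 0.
  by rewrite -(D0 measurableT) preimage_setT.
have ig : P.-integrable setT (fun w => (g (X w) * D w)%:E).
  exact: integrable_bounded_mul hM iD.
have : \int[P]_w ((g (X w) + M) * D w)%:E =
    \int[P]_w (g (X w) * D w)%:E + M%:E * \int[P]_w (D w)%:E.
  rewrite -integralZl// -integralD//; last exact: integrableZl.
  by apply: eq_integral => w _; rewrite -EFinM -EFinD mulrDl.
by rewrite -(h (@ereal_hausdorff R)) iDT mule0 adde0 => <-.
Qed.

End conditional_expectation.

Section is_cond_expectation.
Context d (T : measurableType d) (R : realType) (P : probability T R).
Variables (X : {RV P >-> R}) (Y Z : T -> \bar R).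
Hypothesis YZ : is_cond_expectation P X Y Z.
Local Open Scope ereal_scope.

Lemma g_sigma_algebra_preimage_measurable (A : set T) :
  g_sigma_algebra_preimage X A -> measurable A.
Proof. by move=> [B mB <-]; rewrite setTI -[X in measurable X]setTI; exact: measurable_funP. Qed.

Lemma cond_expectation_preimage (B : set (\bar R)) : measurable B ->
  g_sigma_algebra_preimage X (Z @^-1` B).
Proof.
move=> mB; have [mZ _] := YZ.
by have := mZ measurableT _ mB; rewrite setTI.
Qed.

Lemma cond_expectation_measurable : measurable_fun setT Z.
Proof.
move=> _ B mB; rewrite setTI; apply: g_sigma_algebra_preimage_measurable.
exact: cond_expectation_preimage.
Qed.

Lemma cond_expectation_itv (B : set R) : measurable B ->
  \int[P]_(w in X @^-1` B) Z w = \int[P]_(w in X @^-1` B) Y w.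
Proof. by move=> mB; apply: YZ.2; exists B => //; rewrite setTI. Qed.

(** The event Z >= 0 is X-measurable, so the integrals of Z over it and over its
    complement are integrals of Y. *)
Lemma cond_expectation_integrable : P.-integrable setT Y -> P.-integrable setT Z.
Proof.
move=> iY; have mZ := cond_expectation_measurable.
pose A := Z @^-1` [set x | 0 <= x].
have mB : measurable [set x : \bar R | 0 <= x].
  rewrite (_ : [set x | _] = [set` `[0, +oo[]); first exact: emeasurable_itv.
  by apply/seteqP; split => x /=; rewrite in_itv/= andbT.
have gA : g_sigma_algebra_preimage X A by exact: cond_expectation_preimage.
have gAC : g_sigma_algebra_preimage X (~` A).
  by rewrite /A preimage_setC; apply: cond_expectation_preimage; exact: measurableC.
have mA := g_sigma_algebra_preimage_measurable gA.
have mAC := g_sigma_algebra_preimage_measurable gAC.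
have fin B : measurable B -> \int[P]_(w in B) Y w \is a fin_num.
  by move=> mB'; apply: integrable_fin_num => //; exact: integrableS iY.
apply/integrableP; split => //.
rewrite -(setUv A) ge0_integral_setU//; last 2 first.
- by rewrite setUv; exact: measurableT_comp.
- by apply/disj_set2P; rewrite setICr.
apply: lte_add_pinfty.
  rewrite (_ : \int[P]_(w in A) _ = \int[P]_(w in A) Z w); last first.
    by apply: eq_integral => w /set_mem /gee0_abs.
  by rewrite YZ.2// ltey_eq fin.
have N0 w : (~` A) w -> 0 <= - Z w.
  by move=> /negP; rewrite -ltNge oppe_ge0 => /ltW.
have : \int[P]_(w in ~` A) Z w = - \int[P]_(w in ~` A) - Z w.
  by rewrite -integral_ge0N//; apply: eq_integral => w _; rewrite oppeK.
rewrite YZ.2// => /(congr1 (fun u => - u)); rewrite oppeK => E.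
rewrite (_ : \int[P]_(w in ~` A) _ = \int[P]_(w in ~` A) - Z w); last first.
  by apply: eq_integral => w /set_mem /N0 h; rewrite -abseN gee0_abs.
by rewrite -E ltey_eq fin_numN fin.
Qed.

End is_cond_expectation.

Section version.
Context d (T : measurableType d) (R : realType) (P : probability T R).
Local Open Scope ereal_scope.

Lemma integrable_ae_eq (Y Z : T -> \bar R) : measurable_fun setT Z ->
  {ae P, forall w, Y w = Z w} -> P.-integrable setT Y -> P.-integrable setT Z.
Proof.
move=> mZ YZ iY; apply/integrableP; split => //.
rewrite -(@ge0_ae_eq_integral _ _ _ P setT (fun w => `|Y w|))//.
- by case/integrableP : iY.
- by apply: measurableT_comp => //; exact: measurable_int iY.
- exact: measurableT_comp.
- move: YZ; apply: filterS.
  by move=> w -> _.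
Qed.

(** In the form required by [bounded_fun_orthogonal], for a version of the
    conditional expectation with finite values. *)
Lemma cond_expectation_residual (X : {RV P >-> R}) (Y S : T -> R) (Z : T -> \bar R) :
  is_cond_expectation P X (EFin \o Y) Z ->
  P.-integrable setT (EFin \o Y) -> P.-integrable setT (EFin \o S) ->
  {ae P, forall w, Z w = (S w)%:E} ->
  forall B : set R, measurable B -> \int[P]_(w in X @^-1` B) (S w - Y w)%:E = 0.
Proof.
move=> YZ iY iS ZS B mB; have iZ := cond_expectation_integrable YZ iY.
have mXB : measurable (X @^-1` B).
  by rewrite -[X in measurable X]setTI; exact: measurable_funP.
have iA (U : T -> \bar R) : P.-integrable setT U -> P.-integrable (X @^-1` B) U.
  exact: integrableS.
under eq_integral do rewrite EFinB.
rewrite integralB//; [|exact: iA|exact: iA].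
rewrite -(cond_expectation_itv YZ mB).
rewrite (@ae_eq_integral _ _ _ P _ Z (EFin \o S))//.
- by rewrite subee// integrable_fin_num//; exact: iA.
- by apply: measurable_funTS; exact: measurable_int iS.
- by apply: measurable_funTS; exact: measurable_int iZ.
- by move: ZS; apply: filterS => w ->.
Qed.

End version.

(** * The expectation of a Stein pair *)

Section stein_pair.
Context d (T : measurableType d) (R : realType) (P : probability T R).
Variables (V V' Rem : {RV P >-> R}) (a b lambda : R).
Hypotheses (l0 : 0 < lambda) (ab0 : a + b != 0).
Hypothesis idd : identically_distributed V V'.
Hypotheses (iV : P.-integrable setT (EFin \o V))
  (iY : P.-integrable setT (fun w => (V' w - V w)%:E))
  (iRem : P.-integrable setT (EFin \o Rem)).
Hypothesis regression : forall B : set R, measurable B ->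
  (\int[P]_(w in V @^-1` B) ((lambda * (a + b) * (a / (a + b) - V w) + Rem w)
     - (V' w - V w))%:E = 0)%E.

Variables (f phi F h : R -> R) (A K m : R).
Hypotheses (fc : continuous f) (fA : forall x, `|f x| <= A).
Hypothesis (dF : forall x : R, is_derive x 1 F (f x)).
Hypothesis (taylor : forall x y,
  `|F y - F x - f x * (y - x) - phi x * (y - x) ^+ 2 / 2| <= K / 6 * `|y - x| ^+ 3).
Hypothesis (ode : forall x,
  x * (1 - x) * phi x + (a - (a + b) * x) * f x = h x - m).
Hypothesis (ih : P.-integrable setT (fun w => (h (V w))%:E)).

Variable S : T -> R.
Hypotheses (i1 : P.-integrable setT (fun w => (phi (V w) * (V w * (1 - V w)))%:E))
  (i2 : P.-integrable setT (fun w => (phi (V w) * (V' w - V w) ^+ 2)%:E))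
  (i2' : P.-integrable setT (fun w => (phi (V w) * S w)%:E))
  (S_phi : \int[P]_w (phi (V w) * (V' w - V w) ^+ 2) = \int[P]_w (phi (V w) * S w)).

Let mf : measurable_fun setT f := continuous_measurable_fun fc.

Let iD (g1 g2 : T -> R) : P.-integrable setT (fun w => (g1 w)%:E) ->
  P.-integrable setT (fun w => (g2 w)%:E) ->
  P.-integrable setT (fun w => (g1 w + g2 w)%:E).
Proof. by move=> h1 h2; have := integrableD measurableT h1 h2. Qed.

Let iZ (c : R) (g : T -> R) : P.-integrable setT (fun w => (g w)%:E) ->
  P.-integrable setT (fun w => (c * g w)%:E).
Proof. by move=> h1; have := integrableZl measurableT c h1. Qed.

Let iB (g1 g2 : T -> R) : P.-integrable setT (fun w => (g1 w)%:E) ->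
  P.-integrable setT (fun w => (g2 w)%:E) ->
  P.-integrable setT (fun w => (g1 w - g2 w)%:E).
Proof. by move=> h1 h2; have := integrableB measurableT h1 h2. Qed.

Let Fc : continuous F.
Proof. by move=> x; exact: is_derive_continuous (dF x). Qed.

Let iF (U : {RV P >-> R}) : P.-integrable setT (EFin \o U) ->
  P.-integrable setT (fun w => (F (U w))%:E).
Proof.
move=> iU; have FA := lipschitz_off01 Fc (fun x _ _ => dF x) (fun x _ _ => fA x).
have ibd : P.-integrable setT (fun w => (`|F 0| + A * `|U w|)%:E).
  by apply: iD; [exact: finite_measure_integrable_cst|apply: iZ; exact: integrable_norm].
apply: le_integrable ibd => //.
  apply/measurable_EFinP; apply: measurableT_comp => //.
  exact: continuous_measurable_fun.
move=> w _ /=; rewrite lee_fin (le_trans _ (ler_norm _))//.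
have := FA (U w) 0; rewrite subr0.
by have := ler_normD (F (U w) - F 0) (F 0); rewrite subrK; lra.
Qed.

Let iV' : P.-integrable setT (EFin \o V').
Proof.
have := iD iV iY; apply: eq_integrable => // w _ /=.
by rewrite addrC subrK.
Qed.

Let F_mean : \int[P]_w (F (V' w) - F (V w)) = 0.
Proof.
rewrite RintegralB//; [|exact: iF|exact: iF].
apply/eqP; rewrite subr_eq0; apply/eqP; rewrite /Rintegral; congr fine.
have mF : measurable_fun setT (EFin \o F).
  by apply/measurable_EFinP; exact: continuous_measurable_fun.
have := integral_distribution mF (iF iV); have := integral_distribution mF (iF iV').
move=> <- <-; apply: eq_measure_integral => B mB _; apply/esym; exact: idd.
Qed.

(* the Taylor remainder of F, of order 3 *)
Let r w := F (V' w) - F (V w) - f (V w) * (V' w - V w)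
  - phi (V w) * (V' w - V w) ^+ 2 / 2.

Let ifY : P.-integrable setT (fun w => (f (V w) * (V' w - V w))%:E).
Proof. exact: integrable_bounded_mul mf fA iY. Qed.

Let ifR : P.-integrable setT (fun w => (f (V w) * Rem w)%:E).
Proof. exact: integrable_bounded_mul mf fA iRem. Qed.

Let i2h : P.-integrable setT (fun w => (phi (V w) * (V' w - V w) ^+ 2 / 2)%:E).
Proof.
have := iZ 2^-1 i2; apply: eq_integrable => // w _.
by rewrite [in RHS]mulrC.
Qed.

Let ir : P.-integrable setT (fun w => (r w)%:E).
Proof. by apply: iB => //; apply: iB => //; apply: iB; exact: iF. Qed.

Let Er : \int[P]_w r w =
  - (\int[P]_w (f (V w) * (V' w - V w))) - 2^-1 * (\int[P]_w (phi (V w) * S w)).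
Proof.
have iFF : P.-integrable setT (fun w => (F (V' w) - F (V w))%:E).
  by apply: iB; exact: iF.
rewrite /r RintegralB//; last exact: iB.
rewrite RintegralB// F_mean sub0r -S_phi -RintegralZl//; congr (_ - _).
by apply: eq_Rintegral => w _; rewrite mulrC.
Qed.

Let ilin : P.-integrable setT (fun w =>
  (lambda * (a + b) * (a / (a + b) - V w) + Rem w)%:E).
Proof.
apply: iD => //; apply: iZ; apply: iB => //.
exact: finite_measure_integrable_cst.
Qed.

Let Ereg : \int[P]_w (f (V w) * (V' w - V w)) =
  \int[P]_w (f (V w) * (lambda * (a + b) * (a / (a + b) - V w) + Rem w)).
Proof.
have := bounded_fun_orthogonal (iB ilin iY) regression mf fA.
move=> /(congr1 fine); rewrite -/(Rintegral _ _ _) => E.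
apply/esym/eqP; rewrite -subr_eq0 -RintegralB//; last first.
  exact: integrable_bounded_mul mf fA ilin.
apply/eqP; rewrite -[RHS]E; apply: eq_Rintegral => w _.
by ring.
Qed.

(** Since E F(V') = E F(V), expanding F(V') around V gives
      0 = E [f(V) (V' - V)] + E [phi(V) (V' - V)^2] / 2 + E r.
    The regression identity turns the first term into
    lambda E [(a - (a + b) V) f(V)] + E [f(V) Rem], and the Stein equation replaces
    (a - (a + b) V) f(V) by h(V) - m - V (1 - V) phi(V). *)
Lemma stein_pair_identity :
  \int[P]_w h (V w) - m =
  \int[P]_w (phi (V w) * (V w * (1 - V w)) - (2 * lambda)^-1 * (phi (V w) * S w))
  - lambda^-1 * (\int[P]_w r w) - lambda^-1 * (\int[P]_w (f (V w) * Rem w)).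
Proof.
have ln : lambda != 0 by rewrite gt_eqF.
have icst : P.-integrable setT (fun _ => m%:E) by exact: finite_measure_integrable_cst.
have im : \int[P]_w m = m by rewrite Rintegral_cst//= probability_setT/= mulr1.
have ifL : P.-integrable setT (fun w =>
    (f (V w) * (lambda * (a + b) * (a / (a + b) - V w) + Rem w))%:E).
  exact: integrable_bounded_mul mf fA ilin.
have E1 : \int[P]_w h (V w) - m = \int[P]_w (phi (V w) * (V w * (1 - V w))) +
   lambda^-1 * (\int[P]_w (f (V w) * (V' w - V w)) - \int[P]_w (f (V w) * Rem w)).
  rewrite Ereg -RintegralB// -RintegralZl//; last exact: iB.
  rewrite -RintegralD//; last by apply: iZ; exact: iB.
  rewrite -{1}im -RintegralB//; apply: eq_Rintegral => w _.
  by rewrite -ode; field; rewrite ln ab0.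
rewrite E1 Er RintegralB//; last exact: iZ.
rewrite RintegralZl//; field.
by rewrite ln.
Qed.

Lemma stein_pair_bound : 0 <= K ->
  (`|\int[P]_w h (V w) - m|%:E <=
   `|\int[P]_w (phi (V w) * (V w * (1 - V w)) - (2 * lambda)^-1 * (phi (V w) * S w))|%:E
   + (K / (6 * lambda))%:E * \int[P]_w (`|V' w - V w| ^+ 3)%:E
   + (A / lambda)%:E * \int[P]_w (`|Rem w|)%:E)%E.
Proof.
move=> K0; rewrite stein_pair_identity.
set I1 := \int[P]_w _; set I2 := \int[P]_w r w; set I3 := \int[P]_w _.
have A0 : 0 <= A by exact: le_trans (fA 0).
have mY3 : measurable_fun setT (fun w => (`|V' w - V w| ^+ 3)%:E).
  apply/measurable_EFinP; apply: measurable_funX; apply: measurableT_comp => //.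
  exact: measurable_funB.
have h2 : ((lambda^-1 * `|I2|)%:E <= (K / (6 * lambda))%:E * \int[P]_w (`|V' w - V w| ^+ 3)%:E)%E.
  have -> : K / (6 * lambda) = lambda^-1 * (K / 6) by rewrite invfM mulrA mulrC mulrA.
  rewrite EFinM [X in (_ <= X * _)%E]EFinM -muleA.
  apply: lee_wpmul2l; first by rewrite lee_fin invr_ge0 ltW.
  rewrite -ge0_integralZl_EFin//; last by rewrite divr_ge0.
  have := le_normr_Rintegral measurableT ir; rewrite -lee_fin => /le_trans; apply.
  rewrite /Rintegral fineK; last first.
    by apply: integrable_fin_num => //; exact: integrable_norm ir.
  apply: ge0_le_integral => //.
  - apply/measurable_EFinP; apply: measurableT_comp => //.
    by apply/measurable_EFinP; exact: measurable_int ir.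
  - exact: emeasurable_funM.
  - by move=> w _; rewrite -EFinM lee_fin; exact: taylor.
have h3 : ((lambda^-1 * `|I3|)%:E <= (A / lambda)%:E * \int[P]_w (`|Rem w|)%:E)%E.
  rewrite EFinM mulrC EFinM -muleA.
  apply: lee_wpmul2l; first by rewrite lee_fin invr_ge0 ltW.
  rewrite -ge0_integralZl_EFin//; last first.
    by apply/measurable_EFinP; apply: measurableT_comp.
  have := le_normr_Rintegral measurableT ifR; rewrite -lee_fin => /le_trans; apply.
  rewrite /Rintegral fineK; last first.
    by apply: integrable_fin_num => //; exact: integrable_norm ifR.
  apply: ge0_le_integral => //.
  - apply/measurable_EFinP; apply: measurableT_comp => //.
    by apply/measurable_EFinP; exact: measurable_int ifR.
  - by apply: emeasurable_funM => //; apply/measurable_EFinP; apply: measurableT_comp.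
  - by move=> w _; rewrite -EFinM lee_fin normrM ler_wpM2r.
apply: (le_trans _ (leeD (leeD (lexx _) h2) h3)).
rewrite -!EFinD lee_fin (le_trans (ler_normB _ _))// lerD//.
  rewrite (le_trans (ler_normB _ _))// lerD// normrM (gtr0_norm (_ : 0 < lambda^-1))//.
  by rewrite invr_gt0.
by rewrite normrM (gtr0_norm (_ : 0 < lambda^-1))// invr_gt0.
Qed.

End stein_pair.

(** * Second moments from a conditional bound *)

Section integrability.
Context d (T : measurableType d) (R : realType) (P : probability T R).
Local Open Scope ereal_scope.

(** The event Z >= 0 is X-measurable, so the integral of Y^2 over it is that of Z,
    and Z is at most c^-1 (1/4 + |X (1 - X) - c Z|) because X (1 - X) <= 1/4. The
    complement contributes at most 0. So a finite first term in the bound on the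
    expectation already provides the second moments. *)
Lemma square_integrable_of_cond (X : {RV P >-> R}) (Y : T -> R) (Z : T -> \bar R)
    (c : R) : (0 < c)%R -> measurable_fun setT Y ->
  is_cond_expectation P X (fun w => (Y w ^+ 2)%:E) Z ->
  \int[P]_w `|(X w * (1 - X w))%:E - c%:E * Z w| < +oo ->
  P.-integrable setT (fun w => (Y w ^+ 2)%:E) /\
  P.-integrable setT (fun w => (X w * (1 - X w))%:E).
Proof.
move=> c0 mY YZ; set U := (fun w => (X w * (1 - X w))%:E - c%:E * Z w) => U_fin.
have mZ := cond_expectation_measurable YZ.
have mX : measurable_fun setT (fun w => (X w * (1 - X w))%:E).
  by apply/measurable_EFinP; apply: measurable_funM => //; exact: measurable_funB.
have mU : measurable_fun setT U by apply: emeasurable_funB => //; exact: emeasurable_funM.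
have mY2 : measurable_fun setT (fun w => (Y w ^+ 2)%:E).
  by apply/measurable_EFinP; exact: measurable_funX.
have iU : P.-integrable setT U by apply/integrableP; split.
pose A := Z @^-1` [set x | 0 <= x].
have mB : measurable [set x : \bar R | 0 <= x].
  rewrite (_ : [set x | _] = [set` `[0, +oo[]); first exact: emeasurable_itv.
  by apply/seteqP; split => x /=; rewrite in_itv/= andbT.
have gA : g_sigma_algebra_preimage X A by exact: cond_expectation_preimage YZ _ mB.
have gAC : g_sigma_algebra_preimage X (~` A).
  rewrite /A preimage_setC; apply: (cond_expectation_preimage YZ).
  exact: measurableC.
have mA := g_sigma_algebra_preimage_measurable gA.
have mAC := g_sigma_algebra_preimage_measurable gAC.
pose G w := (c^-1)%:E * (4^-1%:E + `|U w|).
have G0 w : 0 <= G w.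
  by rewrite mule_ge0 ?lee_fin ?invr_ge0 ?(ltW c0)// adde_ge0// lee_fin invr_ge0.
have mG : measurable_fun setT G.
  apply: emeasurable_funM => //; apply: emeasurable_funD => //.
  exact: measurableT_comp.
have ZG w : Z w <= G w.
  rewrite /G /U; case: (Z w) => [z| |]; last by rewrite leNye.
    rewrite -[leRHS]/((c^-1 * (4^-1 + `|X w * (1 - X w) - c * z|))%:E) lee_fin ler_pdivlMl//.
    have := ler_norm (c * z - X w * (1 - X w)); rewrite distrC.
    have := sqr_ge0 (X w - 2^-1); rewrite expr2; lra.
  by rewrite gt0_muley ?lte_fin//= gt0_muley ?lte_fin ?invr_gt0.
have fA : \int[P]_(w in A) (Y w ^+ 2)%:E < +oo.
  rewrite -YZ.2//; apply: (@le_lt_trans _ _ (\int[P]_(w in A) G w)).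
    by apply: ge0_le_integral => //; exact: measurable_funTS.
  apply: (@le_lt_trans _ _ (\int[P]_w G w)); first exact: ge0_subset_integral.
  rewrite ge0_integralZl_EFin ?invr_ge0 ?(ltW c0)//; last 2 first.
  - by move=> w _; rewrite adde_ge0// lee_fin invr_ge0.
  - by apply: emeasurable_funD => //; exact: measurableT_comp.
  rewrite lte_mul_pinfty ?lee_fin ?invr_ge0 ?(ltW c0)//.
  rewrite ge0_integralD//; last exact: measurableT_comp.
  apply: lte_add_pinfty => //; rewrite integral_cst// -ge0_fin_numE; last first.
    by rewrite mule_ge0// lee_fin invr_ge0.
  by rewrite fin_numM// fin_num_measure.
have fAC : \int[P]_(w in ~` A) (Y w ^+ 2)%:E < +oo.
  rewrite -YZ.2//; apply: (@le_lt_trans _ _ 0) => //.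
  have N0 w : (~` A) w -> 0 <= - Z w.
    by move=> /negP; rewrite -ltNge oppe_ge0 => /ltW.
  rewrite (_ : \int[P]_(w in ~` A) Z w = - \int[P]_(w in ~` A) - Z w).
    by rewrite oppe_le0; apply: integral_ge0.
  by rewrite -integral_ge0N//; apply: eq_integral => w _; rewrite oppeK.
have iY2 : P.-integrable setT (fun w => (Y w ^+ 2)%:E).
  apply/integrableP; split => //.
  under eq_integral do rewrite gee0_abs ?lee_fin ?sqr_ge0//.
  rewrite -(setUv A) ge0_integral_setU//; last 3 first.
  - by rewrite setUv.
  - by move=> w _; rewrite lee_fin sqr_ge0.
  - by apply/disj_set2P; rewrite setICr.
  exact: lte_add_pinfty.
split => //; have iZ := cond_expectation_integrable YZ iY2.
have iS : P.-integrable setT (fun w => `|U w| + c%:E * `|Z w|).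
  by apply: integrableD => //; [exact: integrable_abse|apply: integrableZl => //; exact: integrable_abse].
apply: le_integrable iS => // w _; rewrite /U.
case: (Z w) => [z| |].
- rewrite -[leRHS]/(`|(`|X w * (1 - X w) - c * z| + c * `|z|)%R|%R%:E) lee_fin [leRHS]ger0_norm; last first.
    by rewrite addr_ge0// mulr_ge0// ltW.
  have := ler_normD (X w * (1 - X w) - c * z)%R (c * z)%R; rewrite subrK.
  by rewrite (normrM c) (gtr0_norm c0).
- by rewrite !gt0_muley ?lte_fin//= leey.
- by rewrite gt0_muleNy ?lte_fin//= gt0_muley ?lte_fin//= leey.
Qed.

End integrability.

(** * The bound on expectations *)

(** What is specific to the theorem is the integrability of the terms of
    [stein_pair_bound], which depends on which summands of the claim are finite
    and which have coefficient 0; here K is the essential supremum of the second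
    derivative of h, L its Lipschitz constant and K2 = C2 (L + K). *)
Theorem theorem3p9 (R : realType) (a b : R) (ha : 0 < a) (hb : 0 < b) :
  (exists C1 C2 : R, stein_bounds a b C1 C2) /\
  (forall C1 C2 : R, stein_bounds a b C1 C2 ->
   forall (d : measure_display) (T : measurableType d) (P : probability T R)
     (V V' : {RV P >-> R}) (lambda : R) (Rem : {RV P >-> R})
     (EV EVsq : T -> \bar R),
     identically_distributed V V' ->
     0 < lambda ->
     P.-integrable setT (fun w => (V' w - V w)%:E) ->
     is_cond_expectation P V (fun w => (V' w - V w)%:E) EV ->
     {ae P, forall w, EV w =
       (lambda * (a + b) * (a / (a + b) - V w) + Rem w)%:E} ->
     is_cond_expectation P V (fun w => ((V' w - V w) ^+ 2)%:E) EVsq ->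
   forall h : R -> R, twice_diff_bounded h ->
     ('E_P[fun w => `|h (V w)|%R] < +oo)%E ->
     (`| 'E_P[fun w => h (V w)] - (\int[beta_law a b]_x h x)%R%:E |
      <= C1%:E * (lip_const h)%:E *
           \int[P]_w `| (V w * (1 - V w))%R%:E - (2 * lambda)^-1%R%:E * EVsq w |
         + C2%:E * ((lip_const h)%:E + ess_norm h^`(2)%classic)
             * (6 * lambda)^-1%R%:E * 'E_P[fun w => (`|V' w - V w| ^+ 3)%R]
         + (2 * lip_const h / ((a + b) * lambda))%R%:E
             * 'E_P[fun w => `|Rem w|%R])%E).
Proof.
split; first exact: stein_bounds_exist ha hb.
move=> C1 C2 hC d T P V V' lambda Rem EV EVsq idd l0 iY hEV EVae hEVsq h hh hEh.
have [K [K0 KE hLip hd hK]] := twice_diff_boundedP hh.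
set L := lip_const h; have hL := lip_constP hLip; rewrite -/L in hL.
have L0 : 0 <= L := lip_const_ge0 h.
pose f := stein_sol a b h; pose phi := f^`()%classic.
have ab0 : 0 < a + b by rewrite addr_gt0.
have hc : continuous h := lipschitz_continuous hL.
have fc : continuous f := stein_sol_continuous ha hb hL.
have fA x : `|f x| <= L / (a + b) := stein_sol_le ha hb hL x.
have df (x : R) : is_derive x 1 f (phi x) := stein_sol_is_derive ha hb hL hd hK x.
have phic : continuous phi := stein_sol_derive1_continuous ha hb hL hd hK.
have ode := stein_sol_ode ha hb hL.
set m := (\int[beta_law a b]_x h x)%R in ode *.
have phi_le x : `|phi x| <= C1 * L.
  apply: ess_norm_continuous; last exact: phic.
  by rewrite EFinM; exact: hC.1.
have C1L0 : 0 <= C1 * L := le_trans (normr_ge0 _) (phi_le 0).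
pose K2 := C2 * (L + K).
have ddf_le x : x != 0 -> x != 1 -> `|f^`(2)%classic x| <= K2.
  move=> x0 x1; apply: ess_norm_continuous; last exact: (stein_sol_derive2_continuous ha hb hL hd hK x0 x1).
  have := hC.2 h hh; rewrite [in leRHS]KE -EFinD -EFinM; exact.
have K20 : 0 <= K2.
  have n0 : (2 : R) != 0 by rewrite pnatr_eq0.
  have n1 : (2 : R) != 1 by rewrite -subr_eq0 (_ : 2 - 1 = 1 :> R) ?oner_eq0//; ring.
  exact: le_trans (normr_ge0 _) (ddf_le _ n0 n1).
have phiL := lipschitz_off01 phic
  (fun x x0 x1 => stein_sol_is_derive2 ha hb hL hd x0 x1) ddf_le.
rewrite !unlock in hEh *.
have ih : P.-integrable setT (fun w => (h (V w))%:E).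
  apply/integrableP; split => //; apply/measurable_EFinP.
  by apply: measurableT_comp => //; exact: continuous_measurable_fun.
have EhE : (\int[P]_w (h (V w))%:E = (\int[P]_w h (V w))%R%:E)%E.
  by rewrite /Rintegral fineK//; exact: integrable_fin_num ih.
rewrite [in leLHS]EhE [in leRHS]KE -EFinD -!EFinM -/K2.
rewrite -[leLHS]/(`|\int[P]_w h (V w) - m|%:E)%E.
have cR : 0 <= 2 * L / ((a + b) * lambda) by rewrite divr_ge0 ?mulr_ge0// ltW.
have cK : 0 <= K2 / (6 * lambda) by apply: divr_ge0 => //; apply: mulr_ge0 => //; exact: ltW.
set I1 := (\int[P]_w `|_ - _|)%E.
set I3 := (\int[P]_w (`|V' w - V w| ^+ 3)%:E)%E.
set IR := (\int[P]_w `|Rem w|%:E)%E.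
have I10 : (0 <= I1)%E by exact: integral_ge0.
have I30 : (0 <= I3)%E by apply: integral_ge0 => w _; rewrite lee_fin exprn_ge0.
have IR0 : (0 <= IR)%E by apply: integral_ge0 => w _; rewrite lee_fin.
have t1 : (0 <= (C1 * L)%:E * I1)%E by rewrite mule_ge0.
have t3 : (0 <= (K2 / (6 * lambda))%:E * I3)%E by rewrite mule_ge0.
have tR : (0 <= (2 * L / ((a + b) * lambda))%:E * IR)%E by rewrite mule_ge0.
(* if L = 0 then f and f' vanish, so that h is constant *)
have [L00|Lneq0] := eqVneq L 0.
  have hm x : h x = m.
    have f0 : f x = 0 by apply/eqP; rewrite -normr_le0; have := fA x; rewrite L00 mul0r.
    have p0 : phi x = 0 by apply/eqP; rewrite -normr_le0; have := phi_le x; rewrite L00 mulr0.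
    by apply/eqP; rewrite -subr_eq0 -[_ - _]/(centered a b h x) -ode -/f -/phi f0 p0 !mulr0 addr0.
  have -> : \int[P]_w h (V w) = m.
    under eq_Rintegral do rewrite hm.
    by rewrite Rintegral_cst//= probability_setT/= mulr1.
  by rewrite subrr normr0 !adde_ge0.
have Lgt0 : 0 < L by rewrite lt_def Lneq0.
(* the coefficient of E |Rem| is now positive *)
have [IRoo|IRfin] := eqVneq IR +oo%E.
  rewrite IRoo gt0_muley ?lte_fin ?divr_gt0 ?mulr_gt0// addey ?leey//.
  by rewrite -ltNye (lt_le_trans _ (adde_ge0 t1 t3)).
have iRem : P.-integrable setT (EFin \o Rem).
  by apply/integrableP; split; [exact/measurable_EFinP|rewrite ltey].
pose EVr w := lambda * (a + b) * (a / (a + b) - V w) + Rem w.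
have mEVr : measurable_fun setT (EFin \o EVr).
  apply/measurable_EFinP; apply: measurable_funD => //.
  by apply: measurable_funM => //; exact: measurable_funB.
have iEV := cond_expectation_integrable hEV iY.
have iEVr : P.-integrable setT (EFin \o EVr) by exact: integrable_ae_eq EVae iEV.
have iV : P.-integrable setT (EFin \o V).
  have i1 : P.-integrable setT (fun w => ((lambda * (a + b))^-1)%:E *
      ((lambda * a)%:E - ((EVr w)%:E - (Rem w)%:E)))%E.
    apply: integrableZl => //; apply: integrableB => //.
      exact: finite_measure_integrable_cst.
    exact: integrableB.
  apply: eq_integrable i1 => // w _; congr EFin; rewrite /EVr; field.
  by rewrite !gt_eqF.
have mY : measurable_fun setT (fun w => V' w - V w) by exact: measurable_funB.
have regression := cond_expectation_residual hEV iY iEVr EVae.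
have [|F [_ dF _]] := @antiderivative_exists _ f.
  move=> x y; apply: continuous_compact_integrable; first exact: segment_compact.
  exact: continuous_subspaceT.
have {}dF (x : R) : is_derive x 1 F (f x) by apply: dF; exact: fc.
have taylor x y : `|F y - F x - f x * (y - x) - phi x * (y - x) ^+ 2 / 2| <=
    K2 / 6 * `|y - x| ^+ 3.
  by have := taylor2 x (y - x) dF df phiL; rewrite subrKC.
(* S will be a finite version of the conditional expectation of (V' - V)^2, or 0
   when f' vanishes *)
have conclude (S : T -> R) :
    P.-integrable setT (fun w => (phi (V w) * (V w * (1 - V w)))%:E) ->
    P.-integrable setT (fun w => (phi (V w) * (V' w - V w) ^+ 2)%:E) ->
    P.-integrable setT (fun w => (phi (V w) * S w)%:E) ->
    \int[P]_w (phi (V w) * (V' w - V w) ^+ 2) = \int[P]_w (phi (V w) * S w) ->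
    (`|\int[P]_w (phi (V w) * (V w * (1 - V w)) -
        (2 * lambda)^-1 * (phi (V w) * S w))|%:E <= (C1 * L)%:E * I1)%E ->
    (`|\int[P]_w h (V w) - m|%:E <= (C1 * L)%:E * I1 +
      (K2 / (6 * lambda))%:E * I3 + (2 * L / ((a + b) * lambda))%:E * IR)%E.
  move=> i1 i2 i3 e1 e2.
  have abn : a + b != 0 by rewrite gt_eqF.
  apply: (le_trans (stein_pair_bound l0 abn idd iV iY iRem regression fc fA dF
    taylor ode ih i1 i2 i3 e1 K20)).
  apply: leeD; first exact: leeD.
  apply: lee_wpmul2r => //; rewrite lee_fin.
  (* the bound L / (a + b) on f leaves a factor 2 to spare *)
  have -> : L / (a + b) / lambda = L / ((a + b) * lambda) by rewrite invfM mulrA.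
  by rewrite ler_wpM2r ?invr_ge0 ?mulr_ge0 ?ltW//; lra.
(* if C1 L = 0, the first summand is 0 even if its integral is infinite; in this
   case f' vanishes and so do the integrals that involve it *)
have [C10|C1n0] := eqVneq (C1 * L) 0.
  have p0 x : phi x = 0 by apply/eqP; rewrite -normr_le0; have := phi_le x; rewrite C10.
  have i0 (g : T -> R) : P.-integrable setT (fun w => (phi (V w) * g w)%:E).
    apply: (eq_integrable _ (cst 0%E)) => //; last exact: integrable0.
    by move=> w _; rewrite p0 mul0r.
  have z0 (g : T -> R) : (forall w, g w = 0) -> \int[P]_w g w = 0.
    by move=> g0; under eq_Rintegral do rewrite g0; rewrite Rintegral_cst// mul0r.
  apply: (conclude (cst 0)) => //.
    by rewrite !z0// => w; rewrite p0 mul0r.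
  by rewrite z0 ?normr0// => w; rewrite p0 !mul0r mulr0 subrr.
have C1L_gt0 : 0 < C1 * L by rewrite lt_def C1n0.
have [I1oo|I1fin] := eqVneq I1 +oo%E.
  rewrite I1oo gt0_muley ?lte_fin// addye ?addye ?leey//.
    by rewrite -ltNye (lt_le_trans _ tR).
  by rewrite -ltNye (lt_le_trans _ t3).
have c0 : 0 < (2 * lambda)^-1 by rewrite invr_gt0 mulr_gt0.
have [iY2 iVV] : P.-integrable setT (fun w => ((V' w - V w) ^+ 2)%:E) /\
    P.-integrable setT (fun w => (V w * (1 - V w))%:E).
  by apply: (square_integrable_of_cond c0 mY hEVsq); rewrite ltey.
have iEVsq := cond_expectation_integrable hEVsq iY2.
pose S w := fine (EVsq w).
have SE : {ae P, forall w, EVsq w = (S w)%:E}.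
  have := integrable_ae measurableT iEVsq; apply: filterS => w /(_ I) h1.
  by rewrite fineK.
have iS : P.-integrable setT (EFin \o S).
  have mEVsq := cond_expectation_measurable hEVsq.
  by apply: integrable_ae_eq SE iEVsq; apply/measurable_EFinP; exact: measurableT_comp.
have mphi : measurable_fun setT phi by exact: continuous_measurable_fun.
have iphi (Z : T -> R) : P.-integrable setT (fun w => (Z w)%:E) ->
    P.-integrable setT (fun w => (phi (V w) * Z w)%:E).
  by move=> iZ; exact: integrable_bounded_mul mphi phi_le iZ.
have i1 := iphi _ iVV.
have i2 := iphi _ iY2.
have i3 := iphi _ iS.
apply: (conclude S i1 i2 i3).
  have orth := cond_expectation_residual hEVsq iY2 iS SE.
  have iD : P.-integrable setT (EFin \o (fun w => S w - (V' w - V w) ^+ 2)).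
    by have := integrableB measurableT iS iY2.
  have := bounded_fun_orthogonal iD orth mphi phi_le.
  move=> /(congr1 fine); rewrite -/(Rintegral _ _ _) => E.
  apply/esym/eqP; rewrite -subr_eq0 -RintegralB//.
  apply/eqP; rewrite -[RHS]E; apply: eq_Rintegral => w _.
  by rewrite mulrBr.
pose D w := V w * (1 - V w) - (2 * lambda)^-1 * S w.
have iD : P.-integrable setT (EFin \o D).
  have iS' := integrableZl measurableT (2 * lambda)^-1 iS.
  by have := integrableB measurableT iVV iS'.
have mD : measurable_fun setT (fun w => `|D w|%:E).
  by apply/measurable_EFinP/measurableT_comp => //; exact/measurable_EFinP/(measurable_int P).
have ID : (\int[P]_w `|D w|%:E = I1)%E.
  apply: ge0_ae_eq_integral => //.
    apply: measurableT_comp => //; apply: emeasurable_funB => //.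
      exact: measurable_int iVV.
    by apply: emeasurable_funM => //; exact: measurable_int iEVsq.
  by move: SE; apply: filterS => w ->.
have iphiD := iphi _ iD.
have -> : \int[P]_w (phi (V w) * (V w * (1 - V w)) -
    (2 * lambda)^-1 * (phi (V w) * S w)) = \int[P]_w (phi (V w) * D w).
  by apply: eq_Rintegral => w _; rewrite /D; ring.
rewrite -ID -ge0_integralZl_EFin//.
have := le_normr_Rintegral measurableT iphiD; rewrite -lee_fin => /le_trans; apply.
rewrite /Rintegral fineK; last first.
  by apply: integrable_fin_num => //; exact: integrable_norm iphiD.
apply: ge0_le_integral => //.
- by have := measurable_int _ (integrable_norm iphiD).
- exact: emeasurable_funM.
- by move=> w _; rewrite -EFinM lee_fin normrM ler_wpM2r.
Qed.
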